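(* Let $X$ be a separable Hilbert space, $\Lambda\subset\mathbb{N}$ an infinite lacunary set, $m_1,\dots,m_d\in\mathbb{Z}$ fixed integers, and $f=(f_i)_{1\le i\le d}\in H^2(\mathbb{D},X^d)$ with $\sigma(f_i)\subset\Lambda+m_i$ for each $i$. Suppose the sequence $\big(\hat f_1(k+m_1),\hat f_2(k+m_2),\dots,\hat f_d(k+m_d)\big)_{k\ge0}$ is completely relatively compact in $X^d$. Then $f$ is cyclic for $S^*$ if and only if for every $N\ge0$, $$\operatorname{span}\big\{\big(\hat f_1(k+m_1),\dots,\hat f_d(k+m_d)\big): k\ge N\big\}=X^d.$$
   Context: $H^2(\mathbb{D},Y)$: $Y$-valued power series with square-summable coefficient norms; $X^d$ the Hilbert direct sum of $d$ copies of $X$; coordinates $f_i\in H^2(\mathbb{D},X)$; $\hat f_i(j)=0$ for $j<0$ by convention. $\sigma(g)=\{k:\hat g(k)\ne0\}$; $\Lambda+m=\{\lambda+m:\lambda\in\Lambda\}$. Lacunary: $n_{k+1}/n_k\ge c>1$. $S^*$ the backward shift; cyclic means the closed span of $\{S^{*n}f\}$ is the whole space; span is closed linear span. Completely relatively compact: for every orthogonal projection $P$, $(Pa_k/\|Pa_k\|)_{Pa_k\ne0}$ is relatively compact. *)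

(* Defs.v *)
From Stdlib Require Import Reals Lra ZArith.
From Stdlib Require Fin.
Open Scope R_scope.

Record C := mkC { Cre : R; Cim : R }.
Definition C0 : C := mkC 0 0.
Definition C1 : C := mkC 1 0.
Definition CR (r : R) : C := mkC r 0.
Definition Cadd (a b : C) : C := mkC (Cre a + Cre b) (Cim a + Cim b).
Definition Cmul (a b : C) : C :=
  mkC (Cre a * Cre b - Cim a * Cim b) (Cre a * Cim b + Cim a * Cre b).
Definition Copp (a : C) : C := mkC (- Cre a) (- Cim a).
Definition Cconj (a : C) : C := mkC (Cre a) (- Cim a).

Record IPS := mkIPS {
  carrier :> Type;
  vzero : carrier;
  vadd : carrier -> carrier -> carrier;
  vscal : C -> carrier -> carrier;
  vinner : carrier -> carrier -> C   (* linear in the first argument *)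
}.
Arguments vzero {_}. Arguments vadd {_}. Arguments vscal {_}. Arguments vinner {_}.

Definition vsub {V : IPS} (x y : V) : V := vadd x (vscal (Copp C1) y).
Definition vnorm {V : IPS} (x : V) : R := sqrt (Cre (vinner x x)).

Fixpoint vsum {V : IPS} (N : nat) (g : nat -> V) : V :=
  match N with
  | O => vzero
  | S N' => vadd (vsum N' g) (g N')
  end.

Definition is_hilbert (V : IPS) : Prop :=
  (forall x y z : V, vadd x (vadd y z) = vadd (vadd x y) z) /\
  (forall x y : V, vadd x y = vadd y x) /\
  (forall x : V, vadd x vzero = x) /\
  (forall x : V, vadd x (vscal (Copp C1) x) = vzero) /\
  (forall x : V, vscal C1 x = x) /\
  (forall (a b : C) (x : V), vscal (Cmul a b) x = vscal a (vscal b x)) /\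
  (forall (a : C) (x y : V), vscal a (vadd x y) = vadd (vscal a x) (vscal a y)) /\
  (forall (a b : C) (x : V), vscal (Cadd a b) x = vadd (vscal a x) (vscal b x)) /\
  (forall x y z : V, vinner (vadd x y) z = Cadd (vinner x z) (vinner y z)) /\
  (forall (a : C) (x y : V), vinner (vscal a x) y = Cmul a (vinner x y)) /\
  (forall x y : V, vinner y x = Cconj (vinner x y)) /\
  (forall x : V, 0 <= Cre (vinner x x)) /\
  (forall x : V, vinner x x = C0 -> x = vzero) /\
  (forall u : nat -> V,
     (forall eps, eps > 0 -> exists N, forall n m, (n >= N)%nat -> (m >= N)%nat ->
        vnorm (vsub (u n) (u m)) < eps) ->
     exists l : V, Un_cv (fun n => vnorm (vsub (u n) l)) 0).

Definition separable (V : IPS) : Prop :=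
  exists D : nat -> V, forall (x : V) eps, eps > 0 ->
    exists n, vnorm (vsub x (D n)) < eps.

Fixpoint finsum (n : nat) : (Fin.t n -> C) -> C :=
  match n with
  | O => fun _ => C0
  | S n' => fun g => Cadd (g Fin.F1) (finsum n' (fun i => g (Fin.FS i)))
  end.

Definition powIPS (X : IPS) (d : nat) : IPS :=
  mkIPS (Fin.t d -> X)
        (fun _ => vzero)
        (fun u v i => vadd (u i) (v i))
        (fun a u i => vscal a (u i))
        (fun u v => finsum d (fun i => vinner (u i) (v i))).

Definition is_orth_proj {V : IPS} (P : V -> V) : Prop :=
  (forall x y : V, P (vadd x y) = vadd (P x) (P y)) /\
  (forall (a : C) (x : V), P (vscal a x) = vscal a (P x)) /\
  (forall x : V, P (P x) = P x) /\
  (forall x y : V, vinner (P x) y = vinner x (P y)).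

(** A set is relatively compact: every sequence in it has a subsequence
    converging in V (metric space: closure sequentially compact). *)
Definition rel_compact {V : IPS} (A : V -> Prop) : Prop :=
  forall u : nat -> V, (forall n, A (u n)) ->
    exists (phi : nat -> nat) (l : V),
      (forall n, (phi n < phi (S n))%nat) /\
      Un_cv (fun n => vnorm (vsub (u (phi n)) l)) 0.

Definition completely_rel_compact {V : IPS} (a : nat -> V) : Prop :=
  forall P : V -> V, is_orth_proj P ->
    rel_compact (fun y : V => exists k,
      P (a k) <> vzero /\ y = vscal (CR (/ vnorm (P (a k)))) (P (a k))).

Definition span_tail_full {V : IPS} (a : nat -> V) (N : nat) : Prop :=
  forall (y : V) eps, eps > 0 ->
    exists (M : nat) (c : nat -> C),
      vnorm (vsub y (vsum M (fun j => vscal (c j) (a (N + j)%nat)))) < eps.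

(** * H^2(D, V): sequences of Taylor coefficients, square summable *)
Definition in_H2 {V : IPS} (F : nat -> V) : Prop :=
  exists s, infinite_sum (fun k => (vnorm (F k)) ^ 2) s.

Definition H2_dist_lt {V : IPS} (F G : nat -> V) (eps : R) : Prop :=
  exists s, infinite_sum (fun k => (vnorm (vsub (F k) (G k))) ^ 2) s /\ s < eps ^ 2.

Definition bshift_iter {V : IPS} (n : nat) (F : nat -> V) : nat -> V :=
  fun k => F (k + n)%nat.

Definition cyclic_bshift {V : IPS} (F : nat -> V) : Prop :=
  forall G : nat -> V, in_H2 G -> forall eps, eps > 0 ->
    exists (N : nat) (c : nat -> C),
      H2_dist_lt G (fun k => vsum N (fun n => vscal (c n) (bshift_iter n F k))) eps.

Definition lacunary_infinite (Lam : nat -> Prop) : Prop :=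
  exists (n : nat -> nat) (c : R),
    (forall k, (n k < n (S k))%nat) /\
    (forall x, Lam x <-> exists k, x = n k) /\
    c > 1 /\ (forall k, INR (n (S k)) >= c * INR (n k)).

Definition fhat {X : IPS} (g : nat -> X) (j : Z) : X :=
  if (j <? 0)%Z then vzero else g (Z.to_nat j).

Definition spec_in_shift {X : IPS} (g : nat -> X) (Lam : nat -> Prop) (m : Z) : Prop :=
  forall j : nat, g j <> vzero -> exists l, Lam l /\ Z.of_nat j = (Z.of_nat l + m)%Z.

(* Main.v *)
(** If every tail of the vectors [a_k = (f_i^(k + m_i))_i] spans and [h] is orthogonal to all
    backward shifts of [f], shift the coordinates of [h] so that
    [sum_s <a_(s+n), h_s> = 0] for all [n].  Let [P] be the orthogonal projection onto the closed
    span of the [h_p].  Compactness of the normalized [P a_k] gives [eps] and finitely many [p]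
    with [|<a_k, h_p>| >= eps |P a_k|] for one of them.  For [k] in the lacunary set, taking
    [n = k - p] isolates the term [<a_k, h_p>], and Cauchy-Schwarz yields
    [eps^2 |P a_k|^2 <= (sum_(j > k) |P a_j|^2) * (sum_(q >= 1, k + q in Lam) |h_(p+q)|^2)].
    Each [q] is a difference of two elements of [Lam] in a bounded number of ways, and large
    elements have only large differences, so the second factor, summed over [k >= K], tends to 0 with [K].
    Hence [P a_k = 0] for large [k]; the tails of [a] being total, all [h_p] vanish.

    Conversely, approximating the function with coordinates [y_i z^(M + m_i)] by combinations of
    backward shifts and reading off the coefficients of order [M + m_i] approximates [y] by
    combinations of the [a_k] with [k >= M]. *)

From Stdlib Require Import Reals Lra Lia ZArith.
From Stdlib Require Import Classical ClassicalEpsilon FunctionalExtensionality ProofIrrelevance.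
From Stdlib Require Fin.
From Coquelicot Require Import Rbar Hierarchy Lim_seq Series.
Require Import Defs.
Open Scope R_scope.

(** * Complex numbers by real and imaginary parts *)

Lemma C_ext (a b : C) : Cre a = Cre b -> Cim a = Cim b -> a = b.
Proof. destruct a, b; simpl; intros -> ->; reflexivity. Qed.

Ltac Cring := apply C_ext; simpl; ring.

(** * Inner product spaces *)

(** Real and imaginary parts are kept as two real functions, so that real limits, series and [nra]
    apply to each of them. *)
Definition reip {V : IPS} (x y : V) : R := Cre (vinner x y).
Definition imip {V : IPS} (x y : V) : R := Cim (vinner x y).

Section InnerProduct.
Context {V : IPS} (HV : is_hilbert V).

Lemma inner_addl (x y z : V) : vinner (vadd x y) z = Cadd (vinner x z) (vinner y z).
Proof. apply HV. Qed.

Lemma inner_scall a (x y : V) : vinner (vscal a x) y = Cmul a (vinner x y).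
Proof. apply HV. Qed.

Lemma inner_sym (x y : V) : vinner y x = Cconj (vinner x y).
Proof. apply HV. Qed.

Lemma inner_definite (x : V) : vinner x x = C0 -> x = vzero.
Proof. apply HV. Qed.

Lemma reip_self_ge0 (x : V) : 0 <= reip x x.
Proof. apply HV. Qed.

Lemma inner_addr (x y z : V) : vinner x (vadd y z) = Cadd (vinner x y) (vinner x z).
Proof.
  rewrite (inner_sym (vadd y z) x), (inner_sym y x), (inner_sym z x), inner_addl. Cring.
Qed.

Lemma inner_scalr a (x y : V) : vinner x (vscal a y) = Cmul (Cconj a) (vinner x y).
Proof. rewrite (inner_sym (vscal a y) x), (inner_sym y x), inner_scall. Cring. Qed.

Lemma inner_zerol (y : V) : vinner vzero y = C0.
Proof.
  assert (E : vadd vzero (vscal (Copp C1) vzero) = (vzero : V))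
    by (destruct HV as (_ & _ & _ & addN & _); apply addN).
  apply (f_equal (fun v => vinner v y)) in E. rewrite inner_addl, inner_scall in E.
  rewrite <- E. Cring.
Qed.

Lemma imip_self (x : V) : imip x x = 0.
Proof. unfold imip. pose proof (f_equal Cim (inner_sym x x)) as E. simpl in E. lra. Qed.

Lemma reip_sym (x y : V) : reip y x = reip x y.
Proof. unfold reip. rewrite (inner_sym x y). reflexivity. Qed.

Lemma reip_addl (x y z : V) : reip (vadd x y) z = reip x z + reip y z.
Proof. unfold reip. rewrite inner_addl. reflexivity. Qed.

Lemma reip_addr (x y z : V) : reip x (vadd y z) = reip x y + reip x z.
Proof. unfold reip. rewrite inner_addr. reflexivity. Qed.

Lemma reip_subl (x y z : V) : reip (vsub x y) z = reip x z - reip y z.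
Proof. unfold reip, vsub. rewrite inner_addl, inner_scall. simpl. ring. Qed.

Lemma reip_subr (x y z : V) : reip x (vsub y z) = reip x y - reip x z.
Proof. rewrite !(reip_sym _ x). apply reip_subl. Qed.

Lemma imip_subl (x y z : V) : imip (vsub x y) z = imip x z - imip y z.
Proof. unfold imip, vsub. rewrite inner_addl, inner_scall. simpl. ring. Qed.

Lemma reip_CRl r (x y : V) : reip (vscal (CR r) x) y = r * reip x y.
Proof. unfold reip. rewrite inner_scall. simpl. ring. Qed.

Lemma reip_CRr r (x y : V) : reip x (vscal (CR r) y) = r * reip x y.
Proof. rewrite !(reip_sym _ x). apply reip_CRl. Qed.

Lemma imip_CRl r (x y : V) : imip (vscal (CR r) x) y = r * imip x y.
Proof. unfold imip. rewrite inner_scall. simpl. ring. Qed.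

(* [-i (a + i b) = b - i a] *)
Lemma imip_reip (x y : V) : imip x y = reip (vscal (mkC 0 (-1)) x) y.
Proof. unfold imip, reip. rewrite inner_scall. simpl. ring. Qed.

Lemma inner_eq0 (x y : V) : reip x y = 0 -> imip x y = 0 -> vinner x y = C0.
Proof. intros; apply C_ext; assumption. Qed.

Lemma inner_ext (x y : V) : (forall z, vinner x z = vinner y z) -> x = y.
Proof.
  intros E.
  assert (D : vsub x y = vzero).
  { apply inner_definite. unfold vsub at 1. rewrite inner_addl, inner_scall, E. Cring. }
  destruct HV as (addA & addC & add0 & addN & _).
  transitivity (vadd x (vadd (vscal (Copp C1) y) y)).
  - rewrite (addC (vscal _ y) y), addN, add0. reflexivity.
  - rewrite addA. unfold vsub in D. rewrite D, addC, add0. reflexivity.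
Qed.

Lemma inner_self_eq (x : V) : vinner x x = CR (reip x x).
Proof. apply C_ext; [reflexivity | apply imip_self]. Qed.

Lemma vnorm_ge0 (x : V) : 0 <= vnorm x.
Proof. apply sqrt_pos. Qed.

Lemma vnorm_sqr (x : V) : vnorm x ^ 2 = reip x x.
Proof. unfold vnorm. rewrite pow2_sqrt; [reflexivity | apply reip_self_ge0]. Qed.

Lemma reip_self_eq0 (x : V) : reip x x = 0 -> x = vzero.
Proof. intros E. apply inner_definite. rewrite inner_self_eq, E. reflexivity. Qed.

Lemma vnorm_eq0 (x : V) : vnorm x = 0 -> x = vzero.
Proof. intros E. apply reip_self_eq0. rewrite <- vnorm_sqr, E. ring. Qed.

Lemma vnorm_zero : vnorm (vzero : V) = 0.
Proof. unfold vnorm. rewrite inner_zerol. apply sqrt_0. Qed.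

Lemma vnorm_lt (x : V) e : 0 <= e -> reip x x < e ^ 2 -> vnorm x < e.
Proof.
  intros He H. apply Rnot_le_lt; intros C. rewrite <- vnorm_sqr in H.
  assert (e ^ 2 <= vnorm x ^ 2) by (apply pow_incr; lra). lra.
Qed.

Lemma vnorm_eq_of_reip (x y : V) : reip x x = reip y y -> vnorm x = vnorm y.
Proof. unfold vnorm, reip. intros ->. reflexivity. Qed.

Lemma vnorm_scal a (x : V) : vnorm (vscal a x) = sqrt (Cre a ^ 2 + Cim a ^ 2) * vnorm x.
Proof.
  unfold vnorm. rewrite <- sqrt_mult_alt by nra. f_equal.
  rewrite inner_scall, inner_scalr, inner_self_eq. simpl. ring.
Qed.

Lemma vnorm_sub_sym (x y : V) : vnorm (vsub x y) = vnorm (vsub y x).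
Proof.
  apply vnorm_eq_of_reip. rewrite !reip_subl, !reip_subr, (reip_sym y x). ring.
Qed.

(** Cauchy-Schwarz without division: $|b x - r y|^2 = b (|x|^2 b - r^2)$ with $b = |y|^2$ and $r$
    the real part of $<x, y>$. If $b = 0$ then $y = 0$ and $r = 0$. *)
Lemma reip_sqr_le (x y : V) : reip x y ^ 2 <= reip x x * reip y y.
Proof.
  set (r := reip x y); set (b := reip y y).
  assert (H : 0 <= b * (reip x x * b - r ^ 2)).
  { replace (b * (reip x x * b - r ^ 2))
      with (reip (vsub (vscal (CR b) x) (vscal (CR r) y)) (vsub (vscal (CR b) x) (vscal (CR r) y))).
    - apply reip_self_ge0.
    - rewrite !reip_subl, !reip_subr, !reip_CRl, !reip_CRr, (reip_sym x y). fold r b. ring. }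
  pose proof (reip_self_ge0 y) as Hb; fold b in Hb.
  destruct (Rle_lt_or_eq_dec _ _ Hb) as [Hb' | Hb'].
  - assert (0 <= reip x x * b - r ^ 2) by nra. lra.
  - assert (E : y = vzero) by (apply reip_self_eq0; auto).
    assert (r = 0).
    { unfold r. rewrite (reip_sym y x), E. unfold reip. rewrite inner_zerol. reflexivity. }
    nra.
Qed.

Lemma reip_abs_le (x y : V) : Rabs (reip x y) <= vnorm x * vnorm y.
Proof.
  apply Rsqr_incr_0_var.
  - rewrite <- Rsqr_abs. unfold Rsqr.
    pose proof (reip_sqr_le x y) as H. rewrite <- !vnorm_sqr in H. nra.
  - apply Rmult_le_pos; apply vnorm_ge0.
Qed.

Lemma imip_abs_le (x y : V) : Rabs (imip x y) <= vnorm x * vnorm y.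
Proof.
  rewrite imip_reip. eapply Rle_trans; [apply reip_abs_le |].
  rewrite vnorm_scal. simpl. replace (sqrt _) with 1; [lra |].
  rewrite <- sqrt_1 at 1. f_equal. ring.
Qed.

Lemma vnorm_add_le (x y : V) : vnorm (vadd x y) <= vnorm x + vnorm y.
Proof.
  apply Rsqr_incr_0_var.
  - unfold Rsqr. pose proof (vnorm_sqr (vadd x y)) as E.
    rewrite !reip_addl, !reip_addr, (reip_sym x y), <- !vnorm_sqr in E.
    pose proof (reip_abs_le x y). pose proof (Rle_abs (reip x y)). nra.
  - pose proof (vnorm_ge0 x); pose proof (vnorm_ge0 y); lra.
Qed.
End InnerProduct.

(** A vector identity is checked by pairing both sides with an arbitrary vector, which leaves a
    polynomial identity in complex numbers. *)
Ltac vring HV :=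
  apply (inner_ext HV); let z := fresh in intro z; unfold vsub;
  repeat first [rewrite (inner_addl HV) | rewrite (inner_scall HV) | rewrite (inner_zerol HV)];
  Cring.

(** * Convergence in norm *)

Lemma is_lim_seq_inv_succ : is_lim_seq (fun n => / (INR n + 1)) 0.
Proof.
  apply is_lim_seq_ext with (fun n => / INR (S n)).
  { intros n. rewrite S_INR. reflexivity. }
  apply (is_lim_seq_incr_1 (fun n => / INR n)).
  apply (is_lim_seq_inv _ p_infty); [apply is_lim_seq_INR | discriminate].
Qed.

Section Limits.
Context {V : IPS} (HV : is_hilbert V).

Lemma vsub_eq0 (x y : V) : vsub x y = vzero -> x = y.
Proof.
  intros E. replace x with (vadd (vsub x y) y) by vring HV. rewrite E. vring HV.
Qed.

Definition vlim (u : nat -> V) (l : V) : Prop := is_lim_seq (fun n => vnorm (vsub (u n) l)) 0.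

Lemma vlim_reip u l (y : V) : vlim u l -> is_lim_seq (fun n => reip (u n) y) (reip l y).
Proof.
  intros H.
  apply is_lim_seq_ext with (fun n => reip (vsub (u n) l) y + reip l y).
  { intros n. rewrite (reip_subl HV). ring. }
  replace (Finite (reip l y)) with (Finite (0 + reip l y)) by (f_equal; ring).
  apply is_lim_seq_plus'; [| apply is_lim_seq_const].
  apply is_lim_seq_abs_0.
  apply is_lim_seq_le_le with (fun _ => 0) (fun n => vnorm (vsub (u n) l) * vnorm y).
  - intros n; split; [apply Rabs_pos | apply (reip_abs_le HV)].
  - apply is_lim_seq_const.
  - replace (Finite 0) with (Finite (0 * vnorm y)) by (f_equal; ring).
    apply is_lim_seq_mult'; [exact H | apply is_lim_seq_const].
Qed.

Lemma vlim_scal u l a : vlim u l -> vlim (fun n => vscal a (u n)) (vscal a l).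
Proof.
  intros H. unfold vlim.
  apply is_lim_seq_ext with (fun n => sqrt (Cre a ^ 2 + Cim a ^ 2) * vnorm (vsub (u n) l)).
  { intros n. rewrite <- (vnorm_scal HV). f_equal. vring HV. }
  replace (Finite 0) with (Finite (sqrt (Cre a ^ 2 + Cim a ^ 2) * 0)) by (f_equal; ring).
  apply is_lim_seq_mult'; [apply is_lim_seq_const | exact H].
Qed.

Lemma vlim_imip u l (y : V) : vlim u l -> is_lim_seq (fun n => imip (u n) y) (imip l y).
Proof.
  intros H. rewrite (imip_reip HV).
  apply is_lim_seq_ext with (fun n => reip (vscal (mkC 0 (-1)) (u n)) y).
  { intros n. rewrite (imip_reip HV). reflexivity. }
  apply vlim_reip, vlim_scal, H.
Qed.

Lemma vlim_vnorm u l : vlim u l -> is_lim_seq (fun n => vnorm (u n)) (vnorm l).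
Proof.
  intros H.
  apply is_lim_seq_ext with (fun n => (vnorm (u n) - vnorm l) + vnorm l).
  { intros n. ring. }
  replace (Finite (vnorm l)) with (Finite (0 + vnorm l)) by (f_equal; ring).
  apply is_lim_seq_plus'; [| apply is_lim_seq_const].
  apply is_lim_seq_abs_0.
  apply is_lim_seq_le_le with (fun _ => 0) (fun n => vnorm (vsub (u n) l)).
  - intros n; split; [apply Rabs_pos |]. apply Rabs_le. split.
    + assert (E : l = vadd (vsub l (u n)) (u n)) by vring HV.
      pose proof (vnorm_add_le HV (vsub l (u n)) (u n)) as H1. rewrite <- E in H1.
      rewrite (vnorm_sub_sym HV) in H1. lra.
    + assert (E : u n = vadd (vsub (u n) l) l) by vring HV.
      pose proof (vnorm_add_le HV (vsub (u n) l) l) as H1. rewrite <- E in H1. lra.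
  - apply is_lim_seq_const.
  - exact H.
Qed.

Lemma vlim_reip_self u l : vlim u l -> is_lim_seq (fun n => reip (u n) (u n)) (reip l l).
Proof.
  intros H. rewrite <- (vnorm_sqr HV).
  apply is_lim_seq_ext with (fun n => vnorm (u n) * vnorm (u n)).
  { intros n. rewrite <- (vnorm_sqr HV). ring. }
  replace (vnorm l ^ 2) with (vnorm l * vnorm l) by ring.
  apply is_lim_seq_mult'; apply vlim_vnorm, H.
Qed.

Lemma vlim_subl u l (x : V) : vlim u l -> vlim (fun n => vsub x (u n)) (vsub x l).
Proof.
  intros H. eapply is_lim_seq_ext; [| exact H].
  intros n. simpl. rewrite (vnorm_sub_sym HV). f_equal. vring HV.
Qed.

Lemma cauchy_vlim (u : nat -> V) :
  (forall eps, eps > 0 -> exists N, forall n m, (n >= N)%nat -> (m >= N)%nat ->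
     vnorm (vsub (u n) (u m)) < eps) -> exists l, vlim u l.
Proof.
  intros H. destruct HV as (_ & _ & _ & _ & _ & _ & _ & _ & _ & _ & _ & _ & _ & complete).
  destruct (complete u H) as [l Hl]. exists l. apply is_lim_seq_Reals, Hl.
Qed.

Lemma vlim_lt u l eps : vlim u l -> eps > 0 -> exists n, vnorm (vsub l (u n)) < eps.
Proof.
  intros H He. apply is_lim_seq_Reals in H. destruct (H eps He) as [N HN].
  exists N. specialize (HN N (Nat.le_refl N)). unfold R_dist in HN.
  rewrite Rminus_0_r, Rabs_pos_eq in HN by apply vnorm_ge0.
  rewrite (vnorm_sub_sym HV). exact HN.
Qed.

(** * Orthogonal projections *)

Definition is_subspace (E : V -> Prop) : Prop :=
  E vzero /\ (forall x y, E x -> E y -> E (vadd x y)) /\ (forall a x, E x -> E (vscal a x)).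

Definition in_closure (E : V -> Prop) (q : V) : Prop :=
  forall eps, eps > 0 -> exists e, E e /\ vnorm (vsub q e) < eps.

(** [completeness] yields suprema, so the infimum of the squared distances is obtained as [- s],
    with [s] the supremum of their opposites. Points within $1/(n+1)$ of it are then picked by
    choice. *)
Lemma nearest_sequence (E : V -> Prop) (x : V) : (exists e, E e) ->
  exists delta (e : nat -> V), (forall z, E z -> delta <= reip (vsub x z) (vsub x z)) /\
    forall n, E (e n) /\ reip (vsub x (e n)) (vsub x (e n)) < delta + / (INR n + 1).
Proof.
  intros [e0 He0].
  destruct (completeness (fun r => exists e, E e /\ r = - reip (vsub x e) (vsub x e)))
    as [s [ub lub]].
  - exists 0. intros r (e & _ & ->). pose proof (reip_self_ge0 HV (vsub x e)). lra.
  - eauto.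
  - assert (ex : forall n, exists e, E e /\ reip (vsub x e) (vsub x e) < - s + / (INR n + 1)).
    { intros n. apply NNPP; intros C.
      assert (Hn : 0 < / (INR n + 1)) by (apply Rinv_0_lt_compat; pose proof (pos_INR n); lra).
      enough (s <= s - / (INR n + 1)) by lra.
      apply lub. intros r (e & He & ->). apply Rnot_lt_le; intros C'.
      apply C. exists e. split; [exact He | lra]. }
    exists (- s), (fun n => proj1_sig (constructive_indefinite_description _ (ex n))). split.
    + intros z Hz. enough (- reip (vsub x z) (vsub x z) <= s) by lra. apply ub; eauto.
    + intros n. exact (proj2_sig (constructive_indefinite_description _ (ex n))).
Qed.

Lemma quadratic_ge0 b r : 0 <= b -> (forall t, 0 <= t ^ 2 * b - 2 * t * r) -> r = 0.
Proof.
  (* This $t$ is close to the minimizer $r/b$, with $+1$ covering $b = 0$. The quadratic takes there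
     the value $-r^2 (b+2)/(b+1)^2$. *)
  intros Hb H. specialize (H (r / (b + 1))).
  replace ((r / (b + 1)) ^ 2 * b - 2 * (r / (b + 1)) * r)
    with (- (r ^ 2 * (b + 2) / (b + 1) ^ 2)) in H by (field; lra).
  assert (P : 0 < / (b + 1) ^ 2) by (apply Rinv_0_lt_compat; nra).
  unfold Rdiv in H.
  assert (r ^ 2 * (b + 2) <= 0) by nra. nra.
Qed.

(** The limit [q] of a minimizing sequence; since [E] may fail to be closed, [q] is located in its
    closure. *)
Theorem nearest_point (E : V -> Prop) (x : V) : is_subspace E ->
  exists q, in_closure E q /\ forall e, E e -> vinner e (vsub x q) = C0.
Proof.
  intros (E0 & Eadd & Escal).
  destruct (nearest_sequence E x) as (delta & e & Hmin & He); [eauto |].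
  (* Parallelogram law: the midpoint of $e_n$ and $e_m$ lies in [E], so $|e_n - e_m|^2 \le 2/(n+1) +
     2/(m+1)$, which is below $eps^2$ by the choice of [N]. *)
  assert (Cau : exists q, vlim e q).
  { apply cauchy_vlim. intros eps Heps.
    destruct (archimed_cor1 (eps ^ 2 / 4)) as (N & HN & HN0); [nra |].
    exists N. intros n m Hn Hm. apply (vnorm_lt HV); [lra |].
    destruct (He n) as [En Dn], (He m) as [Em Dm].
    assert (B : forall k, (k >= N)%nat -> / (INR k + 1) < eps ^ 2 / 4).
    { intros k Hk. eapply Rle_lt_trans; [| exact HN].
      apply Rinv_le_contravar; [apply lt_0_INR; lia |]. apply le_INR in Hk. lra. }
    pose proof (B n Hn); pose proof (B m Hm).
    pose proof (Hmin (vscal (CR (1/2)) (vadd (e n) (e m)))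
                  (Escal _ _ (Eadd _ _ En Em))) as Hmid.
    rewrite !(reip_subl HV), !(reip_subr HV), ?(reip_CRl HV), ?(reip_CRr HV),
      ?(reip_addl HV), ?(reip_addr HV), ?(reip_CRl HV), ?(reip_CRr HV), ?(reip_addl HV),
      ?(reip_sym HV x (e n)), ?(reip_sym HV x (e m)), ?(reip_sym HV (e n) (e m)) in *.
    lra. }
  destruct Cau as [q Hq]. exists q. split.
  { intros eps Heps. destruct (vlim_lt e q eps Hq Heps) as [n Hn].
    exists (e n). split; [apply He | exact Hn]. }
  assert (Dq : reip (vsub x q) (vsub x q) <= delta).
  { assert (L : is_lim_seq (fun n => delta + / (INR n + 1)) delta).
    { replace (Finite delta) with (Finite (delta + 0)) by (f_equal; ring).
      apply is_lim_seq_plus'; [apply is_lim_seq_const | apply is_lim_seq_inv_succ]. }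
    refine (is_lim_seq_le _ _ _ _ _ (vlim_reip_self _ _ (vlim_subl _ _ x Hq)) L).
    intros n. apply Rlt_le, He. }
  (* First variation: moving from [q] by $t z$ cannot bring the squared distance below [delta],
     hence $t^2 |z|^2 - 2 t r \ge 0$ for all real $t$, with $r$ the real part of $<z, x - q>$. *)
  assert (Re0 : forall z, E z -> reip z (vsub x q) = 0).
  { intros z Ez. apply (quadratic_ge0 (reip z z)); [apply (reip_self_ge0 HV) |].
    intros t.
    assert (delta <= reip (vsub (vsub x (vscal (CR t) z)) q) (vsub (vsub x (vscal (CR t) z)) q)) as D.
    { refine (is_lim_seq_le (fun _ => delta) _ delta _ _ (is_lim_seq_const _)
                (vlim_reip_self _ _ (vlim_subl _ _ (vsub x (vscal (CR t) z)) Hq))).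
      intros n. eapply Rle_trans; [apply (Hmin (vadd (vscal (CR t) z) (e n))) |].
      - apply Eadd; [apply Escal, Ez | apply He].
      - right. f_equal; vring HV. }
    rewrite !(reip_subl HV), !(reip_subr HV), !(reip_CRl HV), !(reip_CRr HV) in D.
    rewrite !(reip_subl HV), !(reip_subr HV) in Dq. rewrite (reip_subr HV).
    rewrite ?(reip_sym HV x z), ?(reip_sym HV q z), ?(reip_sym HV q x) in *.
    rewrite ?(reip_sym HV z x), ?(reip_sym HV z q), ?(reip_sym HV x q) in *. nra. }
  intros z Ez. apply inner_eq0; [apply Re0, Ez |].
  (* The imaginary part is the real part taken at $-i z$, which also lies in [E]. *)
  rewrite (imip_reip HV). apply Re0, Escal, Ez.
Qed.

(** [P x] is the residual of the nearest point of [W], so [P] projects onto the orthogonal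
    complement of [W]. *)
Theorem orthogonal_complement_projection (W : V -> Prop) :
  is_subspace W -> (forall q, in_closure W q -> W q) ->
  exists P : V -> V, is_orth_proj P /\
    forall x, W (vsub x (P x)) /\ forall w, W w -> vinner w (P x) = C0.
Proof.
  intros HW Wcl.
  assert (ex : forall x, exists p, W (vsub x p) /\ forall w, W w -> vinner w p = C0).
  { intros x. destruct (nearest_point W x HW) as (q & Hq & Oq). exists (vsub x q).
    split; [| exact Oq]. replace (vsub x (vsub x q)) with q by vring HV. apply Wcl, Hq. }
  destruct HW as (W0 & Wadd & Wscal).
  pose (P := fun x => proj1_sig (constructive_indefinite_description _ (ex x))).
  assert (HP : forall x, W (vsub x (P x)) /\ forall w, W w -> vinner w (P x) = C0).
  { intros x. exact (proj2_sig (constructive_indefinite_description _ (ex x))). }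
  (* Two candidates differ by a vector of [W] orthogonal to [W]. Additivity, homogeneity and
     idempotence of [P] all reduce to this uniqueness. *)
  assert (uniq : forall x p, W (vsub x p) -> (forall w, W w -> vinner w p = C0) -> P x = p).
  { intros x p Hp Op. apply vsub_eq0. apply (inner_definite HV).
    destruct (HP x) as [Hx Ox].
    assert (Hd : W (vsub (P x) p)).
    { replace (vsub (P x) p) with (vadd (vsub x p) (vscal (Copp C1) (vsub x (P x)))) by vring HV.
      auto. }
    unfold vsub at 2. rewrite (inner_addr HV), (inner_scalr HV), Ox, Op by exact Hd. Cring. }
  (* As $y - P y$ lies in [W], it is orthogonal to $P x$. Applied on both sides, this makes [P]
     self-adjoint. *)
  assert (adj : forall x y, vinner (P x) y = vinner (P x) (P y)).
  { intros x y. destruct (HP x) as [_ Ox], (HP y) as [Hy _].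
    assert (E : y = vadd (vsub y (P y)) (P y)) by vring HV.
    rewrite E at 1. rewrite (inner_addr HV), (inner_sym HV (vsub y (P y))), Ox by exact Hy.
    Cring. }
  exists P. split; [| exact HP]. repeat split.
  - intros x y. apply uniq.
    + replace (vsub (vadd x y) (vadd (P x) (P y)))
        with (vadd (vsub x (P x)) (vsub y (P y))) by vring HV.
      apply Wadd; apply HP.
    + intros w Hw. rewrite (inner_addr HV). rewrite !(proj2 (HP _)) by exact Hw. Cring.
  - intros a x. apply uniq.
    + replace (vsub (vscal a x) (vscal a (P x))) with (vscal a (vsub x (P x))) by vring HV.
      apply Wscal, HP.
    + intros w Hw. rewrite (inner_scalr HV), (proj2 (HP _)) by exact Hw. Cring.
  - intros x. apply uniq; [| apply HP].
    replace (vsub (P x) (P x)) with (vzero : V) by vring HV. exact W0.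
  - intros x y. rewrite (adj x y), (inner_sym HV (P y) x), (adj y x), <- (inner_sym HV).
    reflexivity.
Qed.
End Limits.

(** * Finite powers *)

Lemma finsum_add d (g h : Fin.t d -> C) :
  finsum d (fun i => Cadd (g i) (h i)) = Cadd (finsum d g) (finsum d h).
Proof. induction d; simpl; [| rewrite IHd]; Cring. Qed.

Lemma finsum_mul d a (g : Fin.t d -> C) :
  finsum d (fun i => Cmul a (g i)) = Cmul a (finsum d g).
Proof. induction d; simpl; [| rewrite IHd]; Cring. Qed.

Lemma finsum_conj d (g : Fin.t d -> C) : finsum d (fun i => Cconj (g i)) = Cconj (finsum d g).
Proof. induction d; simpl; [| rewrite IHd]; Cring. Qed.

Lemma finsum_re_ge0 d (g : Fin.t d -> C) : (forall i, 0 <= Cre (g i)) -> 0 <= Cre (finsum d g).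
Proof.
  induction d; simpl; intros H; [lra |].
  pose proof (H Fin.F1). pose proof (IHd (fun i => g (Fin.FS i)) (fun i => H (Fin.FS i))). lra.
Qed.

Lemma finsum_re_le d (g h : Fin.t d -> C) :
  (forall i, Cre (g i) <= Cre (h i)) -> Cre (finsum d g) <= Cre (finsum d h).
Proof.
  induction d; simpl; intros H; [lra |].
  pose proof (H Fin.F1).
  pose proof (IHd (fun i => g (Fin.FS i)) (fun i => h (Fin.FS i)) (fun i => H (Fin.FS i))). lra.
Qed.

Lemma finsum_re_term_le d (g : Fin.t d -> C) i :
  (forall i, 0 <= Cre (g i)) -> Cre (g i) <= Cre (finsum d g).
Proof.
  induction i; simpl; intros H.
  - pose proof (finsum_re_ge0 _ (fun i => g (Fin.FS i)) (fun i => H (Fin.FS i))). lra.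
  - pose proof (H Fin.F1). pose proof (IHi (fun i => g (Fin.FS i)) (fun i => H (Fin.FS i))). lra.
Qed.

Lemma is_lim_seq_finsum_re d (g : nat -> Fin.t d -> C) (l : Fin.t d -> C) :
  (forall i, is_lim_seq (fun n => Cre (g n i)) (Cre (l i))) ->
  is_lim_seq (fun n => Cre (finsum d (g n))) (Cre (finsum d l)).
Proof.
  induction d; simpl; intros H; [apply is_lim_seq_const |].
  apply is_lim_seq_plus'; [apply H | exact (IHd (fun n i => g n (Fin.FS i)) _ (fun i => H _))].
Qed.

Lemma is_series_zero : is_series (fun _ => 0) 0.
Proof.
  apply is_series_Reals. intros eps He. exists 0%nat. intros n _.
  replace (sum_f_R0 _ n) with 0; [rewrite R_dist_eq; exact He |].
  induction n; simpl; [| rewrite <- IHn]; ring.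
Qed.

Lemma is_series_finsum_re d (g : nat -> Fin.t d -> C) (l : Fin.t d -> C) :
  (forall i, is_series (fun n => Cre (g n i)) (Cre (l i))) ->
  is_series (fun n => Cre (finsum d (g n))) (Cre (finsum d l)).
Proof.
  induction d; simpl; intros H.
  - exact is_series_zero.
  - exact (is_series_plus _ _ _ _ (H Fin.F1)
             (IHd (fun n i => g n (Fin.FS i)) _ (fun i => H (Fin.FS i)))).
Qed.

(** Rewriting an imaginary part as the real part of a sum of [CR] terms lets the lemmas about
    [Cre (finsum d _)] serve both parts. *)
Lemma finsum_im d (g : Fin.t d -> C) : Cim (finsum d g) = Cre (finsum d (fun i => CR (Cim (g i)))).
Proof. induction d; simpl; [| rewrite IHd]; reflexivity. Qed.

Lemma reip_pow {X : IPS} d (u v : powIPS X d) :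
  reip u v = Cre (finsum d (fun i => CR (reip (u i) (v i)))).
Proof.
  change (reip u v) with (Cre (finsum d (fun i => vinner (u i) (v i)))).
  induction d; simpl; [reflexivity |]. f_equal.
  apply (IHd (fun i => u (Fin.FS i)) (fun i => v (Fin.FS i))).
Qed.

Lemma imip_pow {X : IPS} d (u v : powIPS X d) :
  imip u v = Cre (finsum d (fun i => CR (imip (u i) (v i)))).
Proof. exact (finsum_im d (fun i => vinner (u i) (v i))). Qed.

Lemma vnorm_coord_le {X : IPS} (HX : is_hilbert X) d (u : powIPS X d) i : vnorm (u i) <= vnorm u.
Proof.
  apply sqrt_le_1_alt. apply (finsum_re_term_le d (fun i => vinner (u i) (u i))).
  intros j. apply (reip_self_ge0 HX).
Qed.

Theorem pow_hilbert {X : IPS} (HX : is_hilbert X) d : is_hilbert (powIPS X d).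
Proof.
  pose proof HX as (addA & addC & add0 & addN & scal1 & scalA & scalDr & scalDl &
    innD & innZ & innC & inn0 & _).
  repeat apply conj; simpl.
  1-8: intros; apply functional_extensionality; intros i; auto.
  - intros x y z. rewrite <- finsum_add. f_equal. apply functional_extensionality; auto.
  - intros a x y. rewrite <- finsum_mul. f_equal. apply functional_extensionality; auto.
  - intros x y. rewrite <- finsum_conj. f_equal. apply functional_extensionality; auto.
  - intros x. apply finsum_re_ge0; auto.
  - intros x Hx. apply functional_extensionality; intros i. apply (reip_self_eq0 HX).
    apply Rle_antisym; [| apply inn0].
    pose proof (finsum_re_term_le d (fun i => vinner (x i) (x i)) i (fun i => inn0 _)) as H.
    rewrite Hx in H. exact H.
  - intros u Hu.
    (* Completeness is coordinatewise: each coordinate is Cauchy, and the squared norm of the error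
       is a finite sum of squared coordinate errors. *)
    assert (ex : forall i, exists l, vlim (fun n => u n i) l).
    { intros i. apply (cauchy_vlim HX). intros eps He. destruct (Hu eps He) as [N HN].
      exists N. intros n m Hn Hm. eapply Rle_lt_trans; [| apply (HN n m Hn Hm)].
      exact (vnorm_coord_le HX d (@vsub (powIPS X d) (u n) (u m)) i). }
    exists (fun i => proj1_sig (constructive_indefinite_description _ (ex i))).
    apply is_lim_seq_Reals. unfold vnorm. rewrite <- sqrt_0.
    apply (is_lim_seq_continuous sqrt); [apply continuity_pt_sqrt; lra |].
    replace (Finite 0) with (Finite (Cre (finsum d (fun _ => C0)))).
    2:{ f_equal. clear. induction d; simpl; [| rewrite IHd]; try ring; reflexivity. }
    apply is_lim_seq_finsum_re. intros i.
    destruct (constructive_indefinite_description _ (ex i)) as [l Hl]. simpl.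
    apply (is_lim_seq_ext (fun n => vnorm (vsub (u n i) l) * vnorm (vsub (u n i) l))).
    { intros n. replace (_ * _) with (vnorm (vsub (u n i) l) ^ 2) by ring. apply (vnorm_sqr HX). }
    replace 0 with (0 * 0) by ring. apply is_lim_seq_mult'; exact Hl.
Qed.

Lemma vsum_coord {X : IPS} d n (g : nat -> powIPS X d) i : vsum n g i = vsum n (fun k => g k i).
Proof. induction n; simpl; [reflexivity |]. rewrite IHn. reflexivity. Qed.

(** * The space of square summable sequences *)

Lemma ex_series_Rle (a b : nat -> R) : (forall n, Rabs (a n) <= b n) -> ex_series b -> ex_series a.
Proof. exact (ex_series_le a b). Qed.

Lemma series_of_bounded_sums (a : nat -> R) M :
  (forall n, 0 <= a n) -> (forall n, sum_n a n <= M) -> ex_series a /\ Series a <= M.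
Proof.
  intros H0 HM.
  assert (L : ex_finite_lim_seq (sum_n a)).
  { apply ex_finite_lim_seq_incr with M; [| exact HM].
    intros n. rewrite sum_Sn. unfold plus; simpl. pose proof (H0 (S n)). lra. }
  destruct L as [l Hl]. assert (S : is_series a l) by exact Hl.
  split; [exists l; exact S |]. rewrite (is_series_unique _ _ S).
  exact (is_lim_seq_le _ (fun _ => M) l M HM Hl (is_lim_seq_const M)).
Qed.

Lemma sum_n_le_Series (a : nat -> R) n :
  (forall n, 0 <= a n) -> ex_series a -> sum_n a n <= Series a.
Proof.
  intros H0 Ha. apply Series_correct in Ha.
  apply (is_lim_seq_incr_compare (sum_n a)); [exact Ha |].
  intros k. rewrite sum_Sn. unfold plus; simpl. pose proof (H0 (S k)). lra.
Qed.

Lemma sum_n_ge0 (a : nat -> R) n : (forall k, 0 <= a k) -> 0 <= sum_n a n.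
Proof. intros H. rewrite sum_n_Reals. apply cond_pos_sum, H. Qed.

Lemma sum_n_term_le (b : nat -> R) n p : (forall k, 0 <= b k) -> (p <= n)%nat -> b p <= sum_n b n.
Proof.
  intros Hb Hp. induction Hp as [| n Hp IH].
  - destruct p; [rewrite sum_O; lra |]. rewrite sum_Sn. unfold plus; simpl.
    pose proof (sum_n_ge0 b p Hb). lra.
  - rewrite sum_Sn. unfold plus; simpl. pose proof (Hb (S n)). lra.
Qed.

Lemma term_le_Series (a : nat -> R) n : (forall n, 0 <= a n) -> ex_series a -> a n <= Series a.
Proof.
  intros H0 Ha. eapply Rle_trans; [apply (sum_n_term_le a n n H0 (Nat.le_refl n)) |].
  apply (sum_n_le_Series a n H0 Ha).
Qed.

Lemma Series_ge0 (a : nat -> R) : (forall n, 0 <= a n) -> ex_series a -> 0 <= Series a.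
Proof. intros H Ha. eapply Rle_trans; [apply (H 0%nat) | apply term_le_Series; auto]. Qed.

Lemma is_lim_seq_sum_n (a : nat -> nat -> R) (l : nat -> R) K :
  (forall k, is_lim_seq (fun n => a n k) (l k)) ->
  is_lim_seq (fun n => sum_n (a n) K) (sum_n l K).
Proof.
  intros H. induction K.
  - rewrite sum_O. apply is_lim_seq_ext with (fun n => a n 0%nat); [| apply H].
    intros n. rewrite sum_O. reflexivity.
  - rewrite sum_Sn. apply is_lim_seq_ext with (fun n => sum_n (a n) K + a n (S K)).
    { intros n. rewrite sum_Sn. reflexivity. }
    apply is_lim_seq_plus'; [exact IHK | apply H].
Qed.

Section SquareSummable.
Context {V : IPS} (HV : is_hilbert V).

Lemma in_H2_ex_series (F : nat -> V) : in_H2 F <-> ex_series (fun k => reip (F k) (F k)).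
Proof.
  split; intros [s Hs]; exists s.
  - apply is_series_Reals in Hs. eapply is_series_ext; [| exact Hs].
    intros n. apply (vnorm_sqr HV).
  - apply is_series_Reals. eapply is_series_ext; [| exact Hs].
    intros n. symmetry. apply (vnorm_sqr HV).
Qed.

Lemma in_H2_le (F : nat -> V) (b : nat -> R) :
  (forall k, reip (F k) (F k) <= b k) -> ex_series b -> in_H2 F.
Proof.
  intros H Hb. apply in_H2_ex_series. apply ex_series_Rle with b; [| exact Hb].
  intros n. rewrite Rabs_pos_eq; [apply H | apply (reip_self_ge0 HV)].
Qed.

Lemma in_H2_zero : in_H2 (fun _ => vzero : V).
Proof.
  exists 0. apply is_series_Reals. apply is_series_ext with (fun _ => 0).
  - intros n. rewrite (vnorm_zero HV). simpl. ring.
  - exact is_series_zero.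
Qed.

Lemma in_H2_add (F G : nat -> V) : in_H2 F -> in_H2 G -> in_H2 (fun k => vadd (F k) (G k)).
Proof.
  rewrite (in_H2_ex_series F), (in_H2_ex_series G). intros HF HG.
  apply in_H2_le with (fun k => 2 * (reip (F k) (F k) + reip (G k) (G k))).
  (* $|F - G|^2 \ge 0$ gives $|F + G|^2 \le 2 (|F|^2 + |G|^2)$. *)
  - intros k. pose proof (reip_self_ge0 HV (vsub (F k) (G k))) as H.
    rewrite !(reip_subl HV), !(reip_subr HV) in H.
    rewrite !(reip_addl HV), !(reip_addr HV). lra.
  - exact (ex_series_scal_l (V := R_NormedModule) 2 _ (ex_series_plus _ _ HF HG)).
Qed.

Lemma in_H2_scal a (F : nat -> V) : in_H2 F -> in_H2 (fun k => vscal a (F k)).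
Proof.
  rewrite (in_H2_ex_series F). intros HF.
  apply in_H2_le with (fun k => (Cre a ^ 2 + Cim a ^ 2) * reip (F k) (F k)).
  - intros k. unfold reip. rewrite (inner_scall HV), (inner_scalr HV), (inner_self_eq HV).
    simpl. right. ring.
  - exact (ex_series_scal_l (V := R_NormedModule) _ _ HF).
Qed.

Lemma ex_series_inner (F G : nat -> V) : in_H2 F -> in_H2 G ->
  ex_series (fun k => reip (F k) (G k)) /\ ex_series (fun k => imip (F k) (G k)).
Proof.
  rewrite (in_H2_ex_series F), (in_H2_ex_series G). intros HF HG.
  assert (B : forall k, vnorm (F k) * vnorm (G k) <= reip (F k) (F k) + reip (G k) (G k)).
  { intros k. rewrite <- !(vnorm_sqr HV). pose proof (vnorm_ge0 (F k)).
    pose proof (vnorm_ge0 (G k)). nra. }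
  pose proof (ex_series_plus _ _ HF HG).
  split; eapply ex_series_Rle; try eassumption; intros k; (eapply Rle_trans; [| apply B]).
  - apply (reip_abs_le HV).
  - apply (imip_abs_le HV).
Qed.

(** The space $H^2$ itself as an [IPS], so that [nearest_point] can be applied to the span of the
    backward shifts. Membership is bundled in a subset type, whence the proof irrelevance in
    [l2_ext]. *)
Definition l2_space : IPS :=
  mkIPS {F : nat -> V | in_H2 F}
    (exist _ _ in_H2_zero)
    (fun F G => exist _ _ (in_H2_add _ _ (proj2_sig F) (proj2_sig G)))
    (fun a F => exist _ _ (in_H2_scal a _ (proj2_sig F)))
    (fun F G => mkC (Series (fun k => reip (proj1_sig F k) (proj1_sig G k)))
                    (Series (fun k => imip (proj1_sig F k) (proj1_sig G k)))).

Definition coef (F : l2_space) (k : nat) : V := proj1_sig F k.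

Lemma l2_ext (F G : l2_space) : (forall k, coef F k = coef G k) -> F = G.
Proof.
  destruct F as [F HF], G as [G HG]; unfold coef; simpl; intros E.
  apply functional_extensionality in E. subst G. f_equal. apply proof_irrelevance.
Qed.

Lemma coef_in_H2 (F : l2_space) : in_H2 (coef F).
Proof. exact (proj2_sig F). Qed.

Lemma coef_ex_series (F : l2_space) : ex_series (fun k => reip (coef F k) (coef F k)).
Proof. apply in_H2_ex_series, coef_in_H2. Qed.

Lemma coef_vnorm_le (F : l2_space) k : vnorm (coef F k) <= vnorm F.
Proof.
  apply sqrt_le_1_alt.
  apply (term_le_Series (fun k => reip (coef F k) (coef F k))); [| apply coef_ex_series].
  intros n. apply (reip_self_ge0 HV).
Qed.

Lemma l2_complete (u : nat -> l2_space) :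
  (forall eps, eps > 0 -> exists N, forall n m, (n >= N)%nat -> (m >= N)%nat ->
     vnorm (vsub (u n) (u m)) < eps) ->
  exists l : l2_space, Un_cv (fun n => vnorm (vsub (u n) l)) 0.
Proof.
  intros Hu.
  assert (ex : forall k, exists l, vlim (fun n => coef (u n) k) l).
  { intros k. apply (cauchy_vlim HV). intros eps He. destruct (Hu eps He) as [N HN].
    exists N. intros n m Hn Hm. eapply Rle_lt_trans; [| apply (HN n m Hn Hm)].
    exact (coef_vnorm_le (vsub (u n) (u m)) k). }
  pose (l := fun k => proj1_sig (constructive_indefinite_description _ (ex k))).
  assert (Hl : forall k, vlim (fun n => coef (u n) k) (l k)).
  { intros k. exact (proj2_sig (constructive_indefinite_description _ (ex k))). }
  pose (D := fun n k => vsub (coef (u n) k) (l k)).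
  (* Each partial sum of $|u_n - u_m|^2$ is at most $eps^2$; letting $m$ tend to infinity in the
     finite sum bounds the partial sums of $|u_n - l|^2$, hence the series. *)
  assert (HD : forall eps, eps > 0 -> exists N, forall n, (n >= N)%nat ->
            ex_series (fun k => reip (D n k) (D n k)) /\
            Series (fun k => reip (D n k) (D n k)) <= eps ^ 2).
  { intros eps He. destruct (Hu eps He) as [N HN]. exists N. intros n Hn.
    apply series_of_bounded_sums; [intros k; apply (reip_self_ge0 HV) |].
    intros K.
    refine (is_lim_seq_le_loc
      (fun m => sum_n (fun k => reip (vsub (coef (u n) k) (coef (u m) k))
                                 (vsub (coef (u n) k) (coef (u m) k))) K)
      (fun _ => eps ^ 2) _ (eps ^ 2) _
      (is_lim_seq_sum_n _ _ _ (fun k => vlim_reip_self HV _ _ (vlim_subl HV _ _ _ (Hl k))))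
      (is_lim_seq_const _)).
    exists N. intros m Hm.
    apply Rle_trans with (vnorm (vsub (u n) (u m)) ^ 2).
    - unfold vnorm. rewrite pow2_sqrt.
      + apply (sum_n_le_Series (fun k => reip (coef (vsub (u n) (u m)) k) (coef (vsub (u n) (u m)) k)));
          [intros k; apply (reip_self_ge0 HV) | apply coef_ex_series].
      + apply (Series_ge0 (fun k => reip (coef (vsub (u n) (u m)) k) (coef (vsub (u n) (u m)) k)));
          [intros k; apply (reip_self_ge0 HV) | apply coef_ex_series].
    - apply pow_incr. split; [apply vnorm_ge0 | apply Rlt_le, HN; assumption]. }
  assert (lH2 : in_H2 l).
  { destruct (HD 1) as [N HN]; [lra |]. destruct (HN N (Nat.le_refl N)) as [H _].
    (* $l = u_N - (u_N - l)$ is a difference of two square summable sequences. *)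
    replace l with (fun k => vadd (coef (u N) k) (vscal (Copp C1) (D N k))).
    - apply in_H2_add; [apply coef_in_H2 | apply in_H2_scal, in_H2_ex_series, H].
    - apply functional_extensionality; intros k. unfold D. vring HV. }
  exists (exist _ l lH2). intros eps He.
  destruct (HD (eps / 2)) as [N HN]; [lra |]. exists N. intros n Hn.
  unfold R_dist. rewrite Rminus_0_r, Rabs_pos_eq by apply vnorm_ge0.
  apply Rle_lt_trans with (eps / 2); [| lra].
  rewrite <- (sqrt_pow2 (eps / 2)) by lra.
  apply sqrt_le_1_alt. exact (proj2 (HN n Hn)).
Qed.

Theorem l2_hilbert : is_hilbert l2_space.
Proof.
  pose proof HV as (addA & addC & add0 & addN & scal1 & scalA & scalDr & scalDl & _).
  assert (ex : forall F G : l2_space, ex_series (fun k => reip (coef F k) (coef G k)) /\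
                 ex_series (fun k => imip (coef F k) (coef G k))).
  { intros F G. apply ex_series_inner; apply coef_in_H2. }
  repeat apply conj.
  1-8: intros; apply l2_ext; intros k; unfold coef; simpl; auto.
  - intros x y z. apply C_ext; simpl.
    + rewrite <- Series_plus by apply ex. apply Series_ext. intros k. apply (reip_addl HV).
    + rewrite <- Series_plus by apply ex. apply Series_ext. intros k.
      unfold imip. rewrite (inner_addl HV). reflexivity.
  - intros a x y.
    destruct (ex x y) as [e1 e2].
    assert (scl : forall c (b : nat -> R), ex_series b -> ex_series (fun k => c * b k)).
    { intros c b. exact (ex_series_scal_l (V := R_NormedModule) c b). }
    apply C_ext; simpl; rewrite <- !Series_scal_l.
    + rewrite <- Series_minus by (apply scl; assumption).
      apply Series_ext. intros k. unfold reip. rewrite (inner_scall HV). reflexivity.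
    + rewrite <- Series_plus by (apply scl; assumption).
      apply Series_ext. intros k. unfold imip. rewrite (inner_scall HV). reflexivity.
  - intros x y. apply C_ext; simpl.
    + apply Series_ext. intros k. apply (reip_sym HV).
    + rewrite <- Series_opp. apply Series_ext. intros k.
      unfold imip. rewrite (inner_sym HV (proj1_sig x k)). reflexivity.
  - intros x. apply (Series_ge0 (fun k => reip (coef x k) (coef x k)));
      [intros k; apply (reip_self_ge0 HV) | apply ex].
  - intros x Hx. apply l2_ext. intros k. apply (reip_self_eq0 HV), Rle_antisym;
      [| apply (reip_self_ge0 HV)].
    apply (f_equal Cre) in Hx. simpl in Hx. rewrite <- Hx.
    apply (term_le_Series (fun k => reip (coef x k) (coef x k)));
      [intros j; apply (reip_self_ge0 HV) | apply ex].
  - exact l2_complete.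
Qed.

Lemma vsum_coef n (g : nat -> l2_space) k : coef (vsum n g) k = vsum n (fun j => coef (g j) k).
Proof. induction n; [reflexivity |]. simpl. rewrite <- IHn. reflexivity. Qed.
End SquareSummable.

(** * Lacunary sets *)

(** A real-valued indicator, so that pairs of members of [Lam] can be counted by real sums and
    weighted inside series. *)
Definition ind (P : Prop) : R := if excluded_middle_informative P then 1 else 0.

Lemma ind_true P : P -> ind P = 1.
Proof. unfold ind. destruct excluded_middle_informative; tauto. Qed.

Lemma ind_false P : ~ P -> ind P = 0.
Proof. unfold ind. destruct excluded_middle_informative; tauto. Qed.

Lemma ind_bounds P : 0 <= ind P <= 1.
Proof. unfold ind. destruct excluded_middle_informative; lra. Qed.

Lemma ind_and P Q : ind (P /\ Q) = ind P * ind Q.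
Proof.
  destruct (classic P) as [p | p], (classic Q) as [q | q].
  - rewrite !ind_true by tauto. ring.
  - rewrite (ind_false (P /\ Q)), (ind_false Q) by tauto. ring.
  - rewrite (ind_false (P /\ Q)), (ind_false P) by tauto. ring.
  - rewrite (ind_false (P /\ Q)), (ind_false P) by tauto. ring.
Qed.

(** Lacunarity freed from the enumeration: the ratio bound is stated for any two members instead of
    consecutive ones. *)
Definition has_ratio (c : R) (Lam : nat -> Prop) : Prop :=
  forall x y, Lam x -> Lam y -> (x < y)%nat -> c * INR x <= INR y.

Lemma lacunary_has_ratio Lam : lacunary_infinite Lam -> exists c, 1 < c /\ has_ratio c Lam.
Proof.
  intros (n & c & incr & mem & Hc & ratio). exists c. split; [lra |].
  assert (mono : forall i j, (i <= j)%nat -> (n i <= n j)%nat).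
  { intros i j Hij. induction Hij; [lia |]. specialize (incr m). lia. }
  intros x y Hx Hy Hxy. apply mem in Hx, Hy. destruct Hx as [i ->], Hy as [j ->].
  assert (Hij : (S i <= j)%nat).
  { apply Nat.nlt_ge; intros C. assert (n j <= n i)%nat by (apply mono; lia). lia. }
  apply Rle_trans with (INR (n (S i))); [apply Rge_le, ratio | apply le_INR, mono, Hij].
Qed.

Section Ratio.
Context {c : R} {Lam : nat -> Prop} (Hc : 1 < c) (HLam : has_ratio c Lam).

(** From $k + q \ge c k$ follows $q \ge (c - 1) k$, which exceeds $Q$ once $k$ is large. *)
Lemma has_ratio_gap Q : exists K, forall k q, (K <= k)%nat -> (1 <= q)%nat -> Lam k -> Lam (k + q)%nat ->
  (Q < q)%nat.
Proof.
  destruct (archimed_cor1 ((c - 1) / (INR Q + 1))) as (K & HK & HK0).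
  { apply Rdiv_lt_0_compat; [lra |]. pose proof (pos_INR Q). lra. }
  exists K. intros k q Hk Hq Lk Lq. apply INR_lt.
  pose proof (HLam k (k + q)%nat Lk Lq ltac:(lia)) as H. rewrite plus_INR in H.
  apply le_INR in Hk. apply lt_0_INR in HK0. pose proof (pos_INR Q).
  assert (E : INR Q + 1 < INR K * (c - 1)).
  { apply (Rmult_lt_compat_r (INR K * (INR Q + 1))) in HK; [| nra].
    field_simplify in HK; try lra. }
  nra.
Qed.

(* For a fixed difference [q], the larger members [k + q] of the pairs grow geometrically,
   while [k + q >= c k] confines them to [[q, q c / (c - 1)]]. *)
Lemma has_ratio_pair_count : exists B, 0 <= B /\ forall q K n, (1 <= q)%nat ->
  sum_n (fun i => ind (Lam (K + i)%nat /\ Lam (K + i + q)%nat)) n <= B.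
Proof.
  destruct (Pow_x_infinity c ltac:(rewrite Rabs_pos_eq; lra) (c ^ 2 / (c - 1) + 1)) as [B HB].
  exists (INR B). split; [apply pos_INR |]. intros q K n Hq.
  assert (Hq' : 1 <= INR q) by (apply (le_INR 1); exact Hq).
  (* Invariant: after $N > 0$ counted pairs, some counted [k] satisfies $k + q \ge q c^{N-1}$. The
     next pair multiplies its larger member by at least $c$. *)
  assert (inv : exists N, sum_n (fun i => ind (Lam (K + i)%nat /\ Lam (K + i + q)%nat)) n = INR N /\
    (N = 0%nat \/ exists k, (k <= K + n)%nat /\ Lam k /\ Lam (k + q)%nat /\
                      INR q * c ^ N <= c * (INR k + INR q))).
  { induction n as [| n (N & EN & IH)].
    - rewrite sum_O. destruct (classic (Lam (K + 0)%nat /\ Lam (K + 0 + q)%nat)) as [p | p].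
      + rewrite ind_true by exact p. exists 1%nat. split; [reflexivity | right].
        exists (K + 0)%nat. repeat split; try tauto; try lia.
        pose proof (pos_INR (K + 0)). simpl. nra.
      + rewrite ind_false by exact p. exists 0%nat. auto.
    - rewrite sum_Sn, EN. unfold plus; simpl AbelianMonoid.sort.
      destruct (classic (Lam (K + S n)%nat /\ Lam (K + S n + q)%nat)) as [p | p].
      + rewrite ind_true by exact p. exists (S N). split; [rewrite S_INR; reflexivity | right].
        exists (K + S n)%nat. repeat split; try tauto; try lia.
        pose proof (pos_INR (K + S n)).
        destruct IH as [-> | (k & Hk & Lk & Lkq & Hpow)]; [simpl; nra |].
        pose proof (HLam (k + q)%nat (K + S n + q)%nat Lkq (proj2 p) ltac:(lia)) as G.
        rewrite !plus_INR in G. rewrite plus_INR. simpl pow. nra.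
      + rewrite ind_false by exact p. exists N. split; [simpl; ring |].
        destruct IH as [-> | (k & Hk & H)]; [auto | right; exists k; split; [lia | exact H]]. }
  destruct inv as (N & -> & H). apply le_INR.
  destruct H as [-> | (k & _ & Lk & Lkq & Hpow)]; [lia |].
  apply Nat.nlt_ge; intros C. specialize (HB N ltac:(lia)).
  rewrite Rabs_pos_eq in HB by (apply pow_le; lra).
  pose proof (HLam k (k + q)%nat Lk Lkq ltac:(lia)) as G. rewrite plus_INR in G.
  (* $c k \le k + q$ gives $(c-1)(k+q) \le c q$. With the invariant, $c^N \le c^2/(c-1)$, against
     the choice of [B]. *)
  assert (Hcq : INR q * ((c - 1) * c ^ N) <= INR q * c ^ 2) by nra.
  apply Rmult_le_reg_l in Hcq; [| lra].
  assert (E : (c - 1) * (c ^ 2 / (c - 1) + 1) = c ^ 2 + (c - 1)) by (field; lra).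
  nra.
Qed.
End Ratio.

(** * Series estimates *)

Lemma ex_series_shift (a : nat -> R) n : ex_series a -> ex_series (fun k => a (n + k)%nat).
Proof. apply ex_series_incr_n. Qed.

Lemma sum_n_le (a b : nat -> R) n : (forall k, a k <= b k) -> sum_n a n <= sum_n b n.
Proof. intros H. rewrite !sum_n_Reals. apply sum_Rle. auto. Qed.

Lemma Series_shift_le (a : nat -> R) n : (forall k, 0 <= a k) -> ex_series a ->
  Series (fun k => a (n + k)%nat) <= Series a.
Proof.
  intros H Ha. destruct n; [right; apply Series_ext; reflexivity |].
  rewrite (Series_incr_n a (S n)) by (auto; lia).
  pose proof (cond_pos_sum a (Nat.pred (S n)) H). lra.
Qed.

Lemma sum_n_Series (g : nat -> nat -> R) n : (forall i, ex_series (g i)) ->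
  ex_series (fun j => sum_n (fun i => g i j) n) /\
  sum_n (fun i => Series (g i)) n = Series (fun j => sum_n (fun i => g i j) n).
Proof.
  intros Hg. induction n as [| n [IHe IH]].
  - split.
    + apply ex_series_ext with (g 0%nat); [| apply Hg]. intros j. rewrite sum_O. reflexivity.
    + rewrite sum_O. apply Series_ext. intros j. rewrite sum_O. reflexivity.
  - assert (E : forall j, sum_n (fun i => g i j) n + g (S n) j = sum_n (fun i => g i j) (S n)).
    { intros j. rewrite sum_Sn. reflexivity. }
    split.
    + eapply ex_series_ext; [exact E |]. exact (ex_series_plus _ _ IHe (Hg (S n))).
    + rewrite sum_Sn, IH. unfold plus; simpl. rewrite <- Series_plus by auto.
      apply Series_ext, E.
Qed.

Lemma Series_tail_small (a : nat -> R) eps : ex_series a -> 0 < eps ->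
  exists Q, Series (fun j => a (Q + j)%nat) < eps.
Proof.
  intros Ha He. pose proof (Series_correct a Ha) as L. apply is_series_Reals in L.
  destruct (L eps He) as [N HN]. exists (S N). specialize (HN N (Nat.le_refl N)).
  rewrite (Series_incr_n a (S N)) in HN by (auto; lia). simpl Nat.pred in HN.
  unfold R_dist in HN. apply Rabs_def2 in HN. lra.
Qed.

(** Summing $2 t |z_j| \le t^2 x_j + y_j$ and optimizing over $t > 0$, with $t = s / \sum x$ for $s
    = |\sum z|$. The termwise hypothesis is the form in which inner products supply it. *)
Lemma Series_cauchy_schwarz (x y z : nat -> R) :
  (forall j, 0 <= x j) -> (forall j, 0 <= y j) -> (forall j, z j ^ 2 <= x j * y j) ->
  ex_series x -> ex_series y -> Series z ^ 2 <= Series x * Series y.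
Proof.
  intros Hx Hy Hz ex ey.
  assert (amgm : forall j t, 0 < t -> Rabs (2 * t * z j) <= t ^ 2 * x j + y j).
  { intros j t Ht. apply Rsqr_incr_0_var.
    - rewrite <- Rsqr_abs. unfold Rsqr. specialize (Hz j).
      assert (t ^ 2 * z j ^ 2 <= t ^ 2 * (x j * y j)) by (apply Rmult_le_compat_l; nra).
      pose proof (pow2_ge_0 (t ^ 2 * x j - y j)). nra.
    - pose proof (Hx j); pose proof (Hy j). nra. }
  assert (exy : forall t, ex_series (fun j => t ^ 2 * x j + y j)).
  { intros t. refine (ex_series_plus (V := R_NormedModule) _ _ _ ey).
    exact (ex_series_scal_l (V := R_NormedModule) _ _ ex). }
  set (s := Rabs (Series z)).
  assert (bound : forall t, 0 < t -> 2 * t * s <= t ^ 2 * Series x + Series y).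
  { intros t Ht. unfold s. rewrite <- (Rabs_pos_eq (2 * t)) by lra.
    rewrite <- Rabs_mult, <- Series_scal_l, <- (Series_scal_l (t ^ 2)), <- Series_plus;
      [| exact (ex_series_scal_l (V := R_NormedModule) _ _ ex) | exact ey].
    assert (ez : ex_series (fun j => Rabs (2 * t * z j))).
    { apply ex_series_Rle with (fun j => t ^ 2 * x j + y j); [| apply exy].
      intros j. rewrite Rabs_Rabsolu. apply amgm, Ht. }
    eapply Rle_trans; [apply Series_Rabs, ez |].
    apply Series_le; [| apply exy]. intros j. split; [apply Rabs_pos | apply amgm, Ht]. }
  replace (Series z ^ 2) with (s ^ 2) by apply pow2_abs.
  pose proof (Series_ge0 x Hx ex) as Px. pose proof (Series_ge0 y Hy ey) as Py.
  assert (Ps : 0 <= s) by apply Rabs_pos.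
  destruct (Rle_lt_or_eq_dec _ _ Ps) as [Ps' | Es]; [| nra].
  destruct (Rle_lt_or_eq_dec _ _ Px) as [Px' | Ex].
  - assert (T : 0 < s / Series x) by (apply Rdiv_lt_0_compat; lra).
    specialize (bound _ T).
    apply (Rmult_le_compat_l (Series x)) in bound; [| lra].
    replace (Series x * (2 * (s / Series x) * s)) with (2 * s ^ 2) in bound by (field; lra).
    replace (Series x * ((s / Series x) ^ 2 * Series x + Series y))
      with (s ^ 2 + Series x * Series y) in bound by (field; lra).
    lra.
  (* When $\sum x = 0 < s$, this $t$ gives $2 (\sum y + 1) \le \sum y$, a contradiction. *)
  - assert (T : 0 < (Series y + 1) / s) by (apply Rdiv_lt_0_compat; lra).
    specialize (bound _ T). rewrite <- Ex in bound.
    replace (2 * ((Series y + 1) / s) * s) with (2 * (Series y + 1)) in bound by (field; lra).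
    lra.
Qed.

(** Here [z j s] stands for a real or imaginary part of $<P a_j, h_s>$. In the vanishing diagonal
    series the terms with $s < p$ are zero by the gap, so the term $s = p$ is minus the sum over $s
    > p$, to which Cauchy-Schwarz applies. The indicator may be inserted because [alpha] vanishes
    off [Lam]. *)
Lemma correlation_bound (Lam : nat -> Prop) (alpha eta : nat -> R) (z : nat -> nat -> R) k p :
  (forall j, 0 <= alpha j) -> (forall j, 0 <= eta j) -> ex_series alpha -> ex_series eta ->
  (forall j, ~ Lam j -> alpha j = 0) ->
  (forall j s, z j s ^ 2 <= alpha j * eta s) ->
  ex_series (fun s => z (s + (k - p))%nat s) ->
  Series (fun s => z (s + (k - p))%nat s) = 0 ->
  (p <= k)%nat -> (forall s, (s < p)%nat -> ~ Lam (s + (k - p))%nat) ->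
  z k p ^ 2 <= Series (fun j => alpha (k + 1 + j)%nat) *
               Series (fun j => ind (Lam (k + 1 + j)%nat) * eta (p + 1 + j)%nat).
Proof.
  intros Ha He ea ee supp bz ez Sz Hpk gap.
  rewrite (Series_incr_n_aux _ p) in Sz.
  2:{ intros s Hs. pose proof (bz (s + (k - p))%nat s) as B. rewrite supp in B by auto. nra. }
  apply (ex_series_shift _ p) in ez. rewrite Series_incr_1 in Sz by exact ez.
  replace (p + 0 + (k - p))%nat with k in Sz by lia. rewrite Nat.add_0_r in Sz.
  replace (z k p ^ 2) with (Series (fun j => z (k + 1 + j)%nat (p + 1 + j)%nat) ^ 2).
  - apply Series_cauchy_schwarz; auto.
    + intros j. apply Rmult_le_pos; [apply ind_bounds | auto].
    + intros j. destruct (classic (Lam (k + 1 + j)%nat)) as [L | L].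
      * rewrite ind_true, Rmult_1_l by exact L. apply bz.
      * pose proof (bz (k + 1 + j)%nat (p + 1 + j)%nat) as B. rewrite supp in * by exact L. lra.
    + apply ex_series_shift, ea.
    + apply ex_series_Rle with (fun j => eta (p + 1 + j)%nat); [| apply ex_series_shift, ee].
      intros j. pose proof (ind_bounds (Lam (k + 1 + j)%nat)). pose proof (He (p + 1 + j)%nat).
      rewrite Rabs_pos_eq; nra.
  - replace (z k p) with (- Series (fun j => z (k + 1 + j)%nat (p + 1 + j)%nat)); [ring |].
    rewrite (Series_ext _ (fun j => z (p + S j + (k - p))%nat (p + S j)%nat)); [lra |].
    intros j. f_equal; lia.
Qed.

(** Let $T$ be the sum of [alpha] from [K] on. Summing the hypothesis over $k \ge K$ and exchanging
    sums weights each [H j] by the number of pairs at distance $1 + j$, which is at most [B], and is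
    $0$ for $j < Q$. Hence $T \le T/2$, so $T = 0$. *)
Lemma lacunary_tail_vanishes c (Lam : nat -> Prop) (alpha H : nat -> R) D K0 :
  1 < c -> has_ratio c Lam -> 0 <= D ->
  (forall k, 0 <= alpha k) -> ex_series alpha -> (forall k, ~ Lam k -> alpha k = 0) ->
  (forall j, 0 <= H j) -> ex_series H ->
  (forall k, (K0 <= k)%nat -> Lam k -> alpha k <=
     D * Series (fun j => alpha (k + 1 + j)%nat) * Series (fun j => ind (Lam (k + 1 + j)%nat) * H j)) ->
  exists K, forall k, (K <= k)%nat -> alpha k = 0.
Proof.
  intros Hc HLam HD Ha ea supp HH eH bound.
  destruct (has_ratio_pair_count Hc HLam) as (B & HB & count).
  (* Chosen so that $D B$ times this tail of [H] is at most $1/2$; the $+1$ keeps the denominator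
     positive when $D B = 0$. *)
  destruct (Series_tail_small H (/ (2 * (D * B + 1))) eH) as [Q HQ].
  { apply Rinv_0_lt_compat. nra. }
  destruct (has_ratio_gap Hc HLam Q) as [K1 gap].
  set (K := (K0 + K1)%nat).
  set (T := Series (fun i => alpha (K + i)%nat)).
  assert (eT : ex_series (fun i => alpha (K + i)%nat)) by apply ex_series_shift, ea.
  assert (T0 : 0 <= T) by (apply Series_ge0; auto).
  pose (g := fun i j => ind (Lam (K + i)%nat /\ Lam (K + i + (1 + j))%nat) * H j).
  assert (eg : forall i, ex_series (g i)).
  { intros i. apply ex_series_Rle with H; [| exact eH]. intros j. unfold g.
    pose proof (ind_bounds (Lam (K + i)%nat /\ Lam (K + i + (1 + j))%nat)). pose proof (HH j).
    rewrite Rabs_pos_eq; nra. }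
  assert (step : forall i, alpha (K + i)%nat <= D * T * Series (g i)).
  { intros i.
    assert (Pg : 0 <= Series (g i)).
    { apply Series_ge0; [| apply eg]. intros j. apply Rmult_le_pos; [apply ind_bounds | apply HH]. }
    destruct (classic (Lam (K + i)%nat)) as [L | L].
    - eapply Rle_trans; [apply bound; [unfold K; lia | exact L] |].
      rewrite (Series_ext (fun j => ind (Lam (K + i + 1 + j)%nat) * H j) (g i)).
      + apply Rmult_le_compat_r; [exact Pg |]. apply Rmult_le_compat_l; [exact HD |].
        rewrite (Series_ext _ (fun j => alpha (K + ((i + 1) + j))%nat)).
        * apply (Series_shift_le (fun i => alpha (K + i)%nat)); auto.
        * intros j. f_equal. lia.
      + intros j. unfold g. rewrite ind_and, (ind_true _ L), Rmult_1_l, Nat.add_assoc. reflexivity.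
    - rewrite supp by exact L. apply Rmult_le_pos; [nra | exact Pg]. }
  assert (half : forall n, sum_n (fun i => alpha (K + i)%nat) n <= T / 2).
  { intros n. eapply Rle_trans; [apply sum_n_le, step |].
    destruct (sum_n_Series g n eg) as [eS ES].
    assert (EM : sum_n (fun i => D * T * Series (g i)) n = D * T * sum_n (fun i => Series (g i)) n)
      by exact (sum_n_mult_l (K := R_Ring) (D * T) (fun i => Series (g i)) n).
    rewrite EM, ES.
    assert (cnt : Series (fun j => sum_n (fun i => g i j) n) <= B * Series (fun j => H (Q + j)%nat)).
    { assert (E : forall j, sum_n (fun i => g i j) n =
         sum_n (fun i => ind (Lam (K + i)%nat /\ Lam (K + i + (1 + j))%nat)) n * H j).
      { intros j. exact (sum_n_mult_r (K := R_Ring) (H j) _ n). }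
      rewrite (Series_incr_n_aux _ Q).
      - rewrite <- Series_scal_l. apply Series_le.
        + intros j. rewrite E. split.
          * apply Rmult_le_pos; [apply sum_n_ge0; intros; apply ind_bounds | apply HH].
          * apply Rmult_le_compat_r; [apply HH | apply count; lia].
        + apply (ex_series_scal_l (V := R_NormedModule) B), ex_series_shift, eH.
      (* Beyond [K] a difference $1 + j$ exceeds $Q$, so indices $j < Q$ count no pair. *)
      - intros j Hj. rewrite E.
        rewrite (sum_n_ext _ (fun _ => 0)).
        + rewrite sum_n_const. ring.
        + intros i. apply ind_false. intros [L1 L2].
          pose proof (gap (K + i)%nat (1 + j)%nat ltac:(unfold K; lia) ltac:(lia) L1 L2). lia. }
    apply Rle_trans with (D * T * (B * Series (fun j => H (Q + j)%nat))).
    - apply Rmult_le_compat_l; [nra | exact cnt].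
    - assert (P : 0 <= Series (fun j => H (Q + j)%nat)).
      { apply Series_ge0; auto. apply ex_series_shift, eH. }
      set (h := Series (fun j => H (Q + j)%nat)) in *.
      apply Rmult_lt_compat_l with (r := 2 * (D * B + 1)) in HQ; [| nra].
      rewrite Rinv_r in HQ by nra.
      assert (D * B * h <= 1 / 2) by nra.
      replace (D * T * (B * h)) with (T * (D * B * h)) by ring. nra. }
  destruct (series_of_bounded_sums _ _ (fun i => Ha (K + i)%nat) half) as [_ Hhalf].
  fold T in Hhalf. exists K. intros k Hk. apply Rle_antisym; [| apply Ha].
  replace k with (K + (k - K))%nat by lia.
  pose proof (term_le_Series (fun i => alpha (K + i)%nat) (k - K) (fun i => Ha _) eT) as Ht.
  fold T in Ht. simpl in Ht. lra.
Qed.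

(** * Vectors orthogonal to the shifts of a lacunary sequence *)

Section LacunaryOrthogonality.
Context {V : IPS} (HV : is_hilbert V).

Lemma reip_zerol (y : V) : reip vzero y = 0.
Proof. unfold reip. rewrite (inner_zerol HV). reflexivity. Qed.

Lemma imip_sqr_le (x y : V) : imip x y ^ 2 <= reip x x * reip y y.
Proof.
  rewrite (imip_reip HV). eapply Rle_trans; [apply (reip_sqr_le HV) |]. right. f_equal.
  unfold reip. rewrite (inner_scall HV), (inner_scalr HV). simpl. ring.
Qed.

(** Continuity of the inner product: if $<e, y> = 0$ then $|<q, y>| = |<q - e, y>| \le |q - e| |y|$,
    and $|q - e|$ can be made arbitrarily small. *)
Lemma closure_orthogonal (E : V -> Prop) (q y : V) :
  in_closure E q -> (forall e, E e -> vinner e y = C0) -> vinner q y = C0.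
Proof.
  intros Hq HE.
  assert (small : forall r, (forall e, E e -> Rabs r <= vnorm (vsub q e) * vnorm y) -> r = 0).
  { intros r Hr. apply NNPP; intros C. apply Rabs_pos_lt in C.
    pose proof (vnorm_ge0 y) as Py.
    destruct (Hq (Rabs r / (vnorm y + 1))) as (e & Ee & He); [apply Rdiv_lt_0_compat; lra |].
    specialize (Hr e Ee).
    apply (Rmult_lt_compat_r (vnorm y + 1)) in He; [| lra].
    replace (Rabs r / (vnorm y + 1) * (vnorm y + 1)) with (Rabs r) in He by (field; lra).
    pose proof (vnorm_ge0 (vsub q e)). nra. }
  apply inner_eq0; apply small; intros e Ee; pose proof (HE e Ee) as E0.
  - replace (reip q y) with (reip (vsub q e) y); [apply (reip_abs_le HV) |].
    rewrite (reip_subl HV). unfold reip at 2. rewrite E0. simpl. ring.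
  - replace (imip q y) with (imip (vsub q e) y); [apply (imip_abs_le HV) |].
    rewrite (imip_subl HV). unfold imip at 2. rewrite E0. simpl. ring.
Qed.

(** Self-adjointness and idempotence give $|x - P x|^2 = |x|^2 - |P x|^2$. *)
Lemma orth_proj_reip_le P (x : V) : is_orth_proj P -> reip (P x) (P x) <= reip x x.
Proof.
  intros (_ & _ & idem & adj).
  assert (E : reip (P x) (P x) = reip x (P x)) by (unfold reip; rewrite adj, idem; reflexivity).
  pose proof (reip_self_ge0 HV (vsub x (P x))) as H.
  rewrite !(reip_subl HV), !(reip_subr HV), (reip_sym HV x (P x)) in H. lra.
Qed.

(** The orthogonal complement of the [h p]. Projecting onto its own complement gives the projection
    onto the closed span of the [h p]. *)
Definition orth_to (h : nat -> V) (w : V) : Prop := forall p, vinner w (h p) = C0.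

Lemma orth_to_subspace h : is_subspace (orth_to h).
Proof.
  repeat split.
  - intros p. apply (inner_zerol HV).
  - intros x y Hx Hy p. rewrite (inner_addl HV), Hx, Hy. Cring.
  - intros a x Hx p. rewrite (inner_scall HV), Hx. Cring.
Qed.

Lemma orth_to_closed h q : in_closure (orth_to h) q -> orth_to h q.
Proof. intros Hq p. apply (closure_orthogonal _ _ _ Hq). intros e He. apply He. Qed.

(* A limit of normalized vectors [P (a k)] failing the bound would be a unit vector lying both
   in [orth_to h] and in its orthogonal complement. *)
Lemma compact_detection (a h : nat -> V) (P : V -> V) :
  completely_rel_compact a -> is_orth_proj P ->
  (forall x w, orth_to h w -> vinner w (P x) = C0) ->
  exists eps r, 0 < eps /\ forall k, P (a k) <> vzero -> exists p, (p <= r)%nat /\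
    (eps * vnorm (P (a k)) <= Rabs (reip (P (a k)) (h p)) \/
     eps * vnorm (P (a k)) <= Rabs (imip (P (a k)) (h p))).
Proof.
  intros comp HP Porth. apply NNPP; intros C.
  (* The failure is used with $eps = 1/(r+1)$ and the first $r + 1$ vectors [h p], giving one bad
     index for each $r$. *)
  assert (ex : forall r : nat, exists k, P (a k) <> vzero /\ forall p, (p <= r)%nat ->
    Rabs (reip (P (a k)) (h p)) < / (INR r + 1) * vnorm (P (a k)) /\
    Rabs (imip (P (a k)) (h p)) < / (INR r + 1) * vnorm (P (a k))).
  { intros r. apply NNPP; intros C'. apply C. exists (/ (INR r + 1)), r.
    split; [apply Rinv_0_lt_compat; pose proof (pos_INR r); lra |].
    intros k Hk. apply NNPP; intros C2. apply C'. exists k. split; [exact Hk |].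
    intros p Hp. split; apply Rnot_le_lt; intros L; apply C2; exists p; tauto. }
  pose (K := fun r => proj1_sig (constructive_indefinite_description _ (ex r))).
  assert (HK : forall r, P (a (K r)) <> vzero /\ forall p, (p <= r)%nat ->
    Rabs (reip (P (a (K r))) (h p)) < / (INR r + 1) * vnorm (P (a (K r))) /\
    Rabs (imip (P (a (K r))) (h p)) < / (INR r + 1) * vnorm (P (a (K r)))).
  { intros r. exact (proj2_sig (constructive_indefinite_description _ (ex r))). }
  pose (u := fun r => vscal (CR (/ vnorm (P (a (K r))))) (P (a (K r)))).
  assert (pos : forall r, 0 < vnorm (P (a (K r)))).
  { intros r. destruct (vnorm_ge0 (P (a (K r)))) as [H | H]; [exact H |].
    exfalso. apply (proj1 (HK r)), (vnorm_eq0 HV). auto. }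
  destruct (comp P HP u) as (phi & l & incr & lim).
  { intros n. exists (K n). split; [apply HK | reflexivity]. }
  assert (Hphi : forall n, (n <= phi n)%nat).
  { induction n; [lia |]. specialize (incr n). lia. }
  assert (L : vlim (fun n => u (phi n)) l) by (apply is_lim_seq_Reals; exact lim).
  assert (unit : reip l l = 1).
  { pose proof (vlim_reip_self HV _ _ L) as L1.
    apply is_lim_seq_unique in L1.
    rewrite (Lim_seq_ext _ (fun _ => 1)), Lim_seq_const in L1; [injection L1; auto |].
    intros n. unfold u. rewrite (reip_CRl HV), (reip_CRr HV), <- (vnorm_sqr HV). field.
    apply Rgt_not_eq, pos. }
  assert (zero : forall (b : nat -> R) (x : R) p, is_lim_seq b x ->
            (forall n, (p <= n)%nat -> Rabs (b n) <= / (INR n + 1)) -> x = 0).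
  { intros b x p Hb Hle.
    assert (b0 : is_lim_seq b 0).
    { apply is_lim_seq_abs_0.
      apply is_lim_seq_le_le_loc with (fun _ => 0) (fun n => / (INR n + 1)).
      - exists p. intros n Hn. split; [apply Rabs_pos | apply Hle, Hn].
      - apply is_lim_seq_const.
      - apply is_lim_seq_inv_succ. }
    apply is_lim_seq_unique in Hb, b0. congruence. }
  assert (mono : forall n, / (INR (phi n) + 1) <= / (INR n + 1)).
  { intros n. apply Rinv_le_contravar; [pose proof (pos_INR n); lra |].
    pose proof (le_INR _ _ (Hphi n)). lra. }
  assert (scaled : forall r x, Rabs x < / (INR r + 1) * vnorm (P (a (K r))) ->
            Rabs (/ vnorm (P (a (K r))) * x) <= / (INR r + 1)).
  { intros r x Hx. pose proof (pos r) as Hr.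
    rewrite Rabs_mult, (Rabs_pos_eq (/ _)) by (apply Rlt_le, Rinv_0_lt_compat, Hr).
    apply Rmult_le_reg_l with (vnorm (P (a (K r)))); [exact Hr |].
    rewrite <- Rmult_assoc, Rinv_r, Rmult_1_l by lra. lra. }
  (* For a fixed [p] the bound $1/(r+1)$ is available as soon as $r \ge p$, so the inner product
     with [h p] vanishes in the limit. *)
  assert (Wl : orth_to h l).
  { intros p. apply inner_eq0.
    - apply (zero _ _ p (vlim_reip HV _ _ (h p) L)). intros n Hn.
      eapply Rle_trans; [| apply mono]. unfold u. rewrite (reip_CRl HV).
      apply scaled, HK. specialize (Hphi n). lia.
    - apply (zero _ _ p (vlim_imip HV _ _ (h p) L)). intros n Hn.
      eapply Rle_trans; [| apply mono]. unfold u. rewrite (imip_CRl HV).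
      apply scaled, HK. specialize (Hphi n). lia. }
  (* All [u n] lie in the range of [P], hence are orthogonal to [l]; passing to the limit gives
     $|l|^2 = 0$, against $|l| = 1$. *)
  assert (l0 : reip l l = 0).
  { apply (zero _ _ 0%nat (vlim_reip HV _ _ l L)). intros n _. unfold u.
    rewrite (reip_CRl HV), (reip_sym HV l). unfold reip. rewrite Porth by exact Wl. simpl.
    rewrite Rmult_0_r, Rabs_R0. apply Rlt_le, Rinv_0_lt_compat. pose proof (pos_INR n). lra. }
  lra.
Qed.

Lemma in_H2_bshift n (F : nat -> V) : in_H2 F -> in_H2 (bshift_iter n F).
Proof.
  rewrite !(in_H2_ex_series HV). intros H. apply (ex_series_shift _ n) in H.
  eapply ex_series_ext; [| exact H]. intros k. unfold bshift_iter. rewrite Nat.add_comm. reflexivity.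
Qed.

Theorem lacunary_orthogonal_eq0 c (Lam : nat -> Prop) (a h : nat -> V) :
  1 < c -> has_ratio c Lam -> in_H2 a -> in_H2 h ->
  (forall k, a k <> vzero -> Lam k) ->
  completely_rel_compact a -> (forall N, span_tail_full a N) ->
  (forall n, Series (fun s => reip (a (s + n)%nat) (h s)) = 0 /\
             Series (fun s => imip (a (s + n)%nat) (h s)) = 0) ->
  forall p, h p = vzero.
Proof.
  intros Hc HLam Ha Hh supp comp span orth.
  destruct (orthogonal_complement_projection HV (orth_to h) (orth_to_subspace h) (orth_to_closed h))
    as (P & HP & Pspec).
  destruct (compact_detection a h P comp HP (fun x => proj2 (Pspec x)))
    as (eps & r & Heps & detect).
  (* $a_k - P a_k$ is orthogonal to every [h p], so [P (a k)] may replace [a k] in all the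
     relations. *)
  assert (innP : forall k p, vinner (a k) (h p) = vinner (P (a k)) (h p)).
  { intros k p. destruct (Pspec (a k)) as [W _]. specialize (W p).
    unfold vsub in W. rewrite (inner_addl HV), (inner_scall HV) in W.
    pose proof (f_equal Cre W). pose proof (f_equal Cim W). simpl in *. apply C_ext; lra. }
  pose (alpha := fun k => reip (P (a k)) (P (a k))).
  pose (eta := fun s => reip (h s) (h s)).
  (* The index [p] that detects [P (a k)] varies with [k]; summing over all $p \le r$ gives one
     weight valid for every [k]. *)
  pose (H := fun j => sum_n (fun p => eta (p + 1 + j)%nat) r).
  assert (a0 : forall k, 0 <= alpha k) by (intros; apply (reip_self_ge0 HV)).
  assert (e0 : forall k, 0 <= eta k) by (intros; apply (reip_self_ge0 HV)).
  assert (ea : ex_series alpha).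
  { apply ex_series_Rle with (fun k => reip (a k) (a k)); [| apply (in_H2_ex_series HV), Ha].
    intros k. rewrite Rabs_pos_eq by apply a0. apply orth_proj_reip_le, HP. }
  assert (ee : ex_series eta) by apply (in_H2_ex_series HV), Hh.
  assert (P0 : P vzero = vzero).
  { apply (reip_self_eq0 HV), Rle_antisym; [| apply (reip_self_ge0 HV)].
    eapply Rle_trans; [apply orth_proj_reip_le, HP |]. rewrite reip_zerol. lra. }
  assert (asupp : forall k, ~ Lam k -> alpha k = 0).
  { intros k Hk. unfold alpha. replace (a k) with (vzero : V); [rewrite P0; apply reip_zerol |].
    symmetry. apply NNPP; intros C. apply Hk, supp, C. }
  assert (eH : ex_series H /\ forall j, 0 <= H j).
  { split; [| intros j; apply sum_n_ge0; auto].
    apply (sum_n_Series (fun p j => eta (p + 1 + j)%nat)). intros i.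
    apply (ex_series_shift eta (i + 1)), ee. }
  destruct eH as [eH H0].
  destruct (has_ratio_gap Hc HLam r) as [K1 gap].
  assert (ex : forall n, ex_series (fun s => reip (a (s + n)%nat) (h s)) /\
                 ex_series (fun s => imip (a (s + n)%nat) (h s))).
  { intros n. apply (ex_series_inner HV (bshift_iter n a)); [apply in_H2_bshift, Ha | exact Hh]. }
  assert (est : forall k, (K1 + r <= k)%nat -> Lam k -> alpha k <= / eps ^ 2 *
     Series (fun j => alpha (k + 1 + j)%nat) * Series (fun j => ind (Lam (k + 1 + j)%nat) * H j)).
  { intros k Hk Lk.
    assert (T0 : 0 <= Series (fun j => alpha (k + 1 + j)%nat)).
    { apply Series_ge0; auto. apply ex_series_shift, ea. }
    assert (mono : forall p, (p <= r)%nat ->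
      Series (fun j => ind (Lam (k + 1 + j)%nat) * eta (p + 1 + j)%nat) <=
      Series (fun j => ind (Lam (k + 1 + j)%nat) * H j)).
    { intros p Hp. apply Series_le.
      - intros j. pose proof (ind_bounds (Lam (k + 1 + j)%nat)) as I. split.
        + apply Rmult_le_pos; [apply I | apply e0].
        + apply Rmult_le_compat_l; [apply I |].
          exact (sum_n_term_le (fun p => eta (p + 1 + j)%nat) r p (fun _ => e0 _) Hp).
      - apply ex_series_Rle with H; [| exact eH]. intros j.
        pose proof (ind_bounds (Lam (k + 1 + j)%nat)). pose proof (H0 j).
        rewrite Rabs_pos_eq; nra. }
    (* Otherwise $s + k - p$ and $k$ would be members at distance $p - s \le r$. The threshold $K1 +
       r$ ensures $s + k - p \ge K1$, where distances exceed $r$. *)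
    assert (gap' : forall p s, (p <= r)%nat -> (s < p)%nat -> ~ Lam (s + (k - p))%nat).
    { intros p s Hp Hs L.
      assert (r < p - s)%nat; [| lia].
      apply (gap (s + (k - p))%nat); [lia | lia | exact L |].
      replace (s + (k - p) + (p - s))%nat with k by lia. exact Lk. }
    assert (fin : forall p x, (p <= r)%nat -> eps * vnorm (P (a k)) <= Rabs x ->
       x ^ 2 <= Series (fun j => alpha (k + 1 + j)%nat) *
                Series (fun j => ind (Lam (k + 1 + j)%nat) * eta (p + 1 + j)%nat) ->
       alpha k <= / eps ^ 2 * Series (fun j => alpha (k + 1 + j)%nat) *
                Series (fun j => ind (Lam (k + 1 + j)%nat) * H j)).
    { intros p x Hp Hx Hsq.
      assert (B : (eps * vnorm (P (a k))) ^ 2 <= x ^ 2).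
      { rewrite <- (pow2_abs x). apply pow_incr. split; [| exact Hx].
        apply Rmult_le_pos; [lra | apply vnorm_ge0]. }
      rewrite Rpow_mult_distr, (vnorm_sqr HV) in B. fold (alpha k) in B.
      pose proof (Rmult_le_compat_l _ _ _ T0 (mono p Hp)).
      apply Rmult_le_reg_l with (eps ^ 2); [nra |].
      rewrite Rmult_assoc, <- Rmult_assoc, Rinv_r by nra. lra. }
    destruct (classic (P (a k) = vzero)) as [E | E].
    - unfold alpha at 1. rewrite E, reip_zerol.
      apply Rmult_le_pos; [apply Rmult_le_pos; [| exact T0] |].
      + apply Rlt_le, Rinv_0_lt_compat, pow_lt, Heps.
      + eapply Rle_trans; [| apply (mono 0%nat); lia]. apply Series_ge0.
        * intros j. apply Rmult_le_pos; [apply ind_bounds | apply e0].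
        * apply ex_series_Rle with (fun j => eta (0 + 1 + j)%nat); [| apply ex_series_shift, ee].
          intros j. pose proof (ind_bounds (Lam (k + 1 + j)%nat)). pose proof (e0 (0 + 1 + j)%nat).
          rewrite Rabs_pos_eq; nra.
    - destruct (detect k E) as (p & Hp & [D | D]).
      + apply (fin p _ Hp D).
        apply (correlation_bound Lam alpha eta (fun j s => reip (P (a j)) (h s))); auto.
        * intros; apply (reip_sqr_le HV).
        * refine (ex_series_ext _ _ _ (proj1 (ex (k - p)%nat))). intros s. unfold reip.
          rewrite innP. reflexivity.
        * rewrite <- (proj1 (orth (k - p)%nat)). apply Series_ext. intros s. unfold reip.
          rewrite innP. reflexivity.
        * lia.
      + apply (fin p _ Hp D).
        apply (correlation_bound Lam alpha eta (fun j s => imip (P (a j)) (h s))); auto.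
        * intros; apply imip_sqr_le.
        * refine (ex_series_ext _ _ _ (proj2 (ex (k - p)%nat))). intros s. unfold imip.
          rewrite innP. reflexivity.
        * rewrite <- (proj2 (orth (k - p)%nat)). apply Series_ext. intros s. unfold imip.
          rewrite innP. reflexivity.
        * lia. }
  destruct (lacunary_tail_vanishes c Lam alpha H (/ eps ^ 2) (K1 + r) Hc HLam) as [K HK]; auto.
  { apply Rlt_le, Rinv_0_lt_compat, pow_lt, Heps. }
  intros p. apply (inner_definite HV).
  (* [h p] is a limit of combinations of the [a k] with $k \ge K$, all orthogonal to [h p] since
     [P (a k)] is zero; hence [h p] is orthogonal to itself. *)
  apply (closure_orthogonal (fun w => vinner w (h p) = C0)); [| auto].
  intros e He. destruct (span K (h p) e He) as (M & co & Hco).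
  eexists. split; [| exact Hco]. clear Hco. induction M; simpl; [apply (inner_zerol HV) |].
  rewrite (inner_addl HV), IHM, (inner_scall HV), innP.
  rewrite (reip_self_eq0 HV (P (a (K + M)%nat)) (HK (K + M)%nat (Nat.le_add_r K M))).
  rewrite (inner_zerol HV). Cring.
Qed.
End LacunaryOrthogonality.

(** * Linear combinations *)

Section LinearCombinations.
Context {V : IPS} (HV : is_hilbert V).

Lemma vsum_ext n (g g' : nat -> V) : (forall j, (j < n)%nat -> g j = g' j) -> vsum n g = vsum n g'.
Proof. induction n; simpl; intros E; [reflexivity |]. rewrite IHn, E by auto. reflexivity. Qed.

Lemma vsum_eq0 n (g : nat -> V) : (forall j, (j < n)%nat -> g j = vzero) -> vsum n g = vzero.
Proof. induction n; simpl; intros E; [reflexivity |]. rewrite IHn, E by auto. vring HV. Qed.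

Lemma vsum_split n m (g : nat -> V) :
  vsum (n + m) g = vadd (vsum n g) (vsum m (fun j => g (n + j)%nat)).
Proof.
  induction m; simpl.
  - rewrite Nat.add_0_r. vring HV.
  - rewrite Nat.add_succ_r. simpl. rewrite IHm. vring HV.
Qed.

Lemma vsum_add n (g g' : nat -> V) :
  vadd (vsum n g) (vsum n g') = vsum n (fun j => vadd (g j) (g' j)).
Proof. induction n; simpl; [| rewrite <- IHn]; vring HV. Qed.

Lemma vsum_scal n a (g : nat -> V) : vscal a (vsum n g) = vsum n (fun j => vscal a (g j)).
Proof. induction n; simpl; [| rewrite <- IHn]; vring HV. Qed.

Definition lin_span (v : nat -> V) (x : V) : Prop :=
  exists n c, x = vsum n (fun j => vscal (c j) (v j)).

(** Zero coefficients bring two combinations to a common length, so that they can be added term by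
    term. *)
Lemma lin_span_pad (v : nat -> V) n m c :
  vsum n (fun j => vscal (c j) (v j)) =
  vsum (n + m) (fun j => vscal (if (j <? n)%nat then c j else C0) (v j)).
Proof.
  rewrite vsum_split, (vsum_eq0 m).
  - rewrite (vsum_ext n (fun j => vscal (if (j <? n)%nat then c j else C0) (v j))
               (fun j => vscal (c j) (v j))); [vring HV |].
    intros j Hj. apply Nat.ltb_lt in Hj. rewrite Hj. reflexivity.
  - intros j _. rewrite (proj2 (Nat.ltb_ge (n + j) n)) by lia. vring HV.
Qed.

Lemma lin_span_subspace (v : nat -> V) : is_subspace (lin_span v).
Proof.
  repeat split.
  - exists 0%nat, (fun _ => C0). reflexivity.
  - intros x y (n & c & ->) (m & c' & ->).
    rewrite (lin_span_pad v n m c), (lin_span_pad v m n c'), (Nat.add_comm m n), vsum_add.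
    exists (n + m)%nat, (fun j => Cadd (if (j <? n)%nat then c j else C0)
                                      (if (j <? m)%nat then c' j else C0)).
    apply vsum_ext. intros j _. vring HV.
  - intros a x (n & c & ->). rewrite vsum_scal. exists n, (fun j => Cmul a (c j)).
    apply vsum_ext. intros j _. vring HV.
Qed.

Lemma lin_span_mem (v : nat -> V) n : lin_span v (v n).
Proof.
  exists (S n), (fun j => if (j =? n)%nat then C1 else C0). simpl. rewrite vsum_eq0.
  - rewrite Nat.eqb_refl. vring HV.
  - intros j Hj. rewrite (proj2 (Nat.eqb_neq j n)) by lia. vring HV.
Qed.
End LinearCombinations.

(** * Shifted coordinates *)

Lemma is_series_pad (phi : nat -> R) (l : R) r : is_series phi l ->
  is_series (fun s => if (s <? r)%nat then 0 else phi (s - r)%nat) l.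
Proof.
  intros H. induction r.
  - eapply is_series_ext; [| exact H]. intros n. simpl. rewrite Nat.sub_0_r. reflexivity.
  - apply is_series_decr_1. replace l with (l + - 0) in IHr by ring. exact IHr.
Qed.

(** A shift by $z \ge 0$ drops initial terms, and a shift by $z < 0$ prepends zeros; neither affects
    convergence. *)
Lemma ex_series_fhat (phi : nat -> R) z : ex_series phi ->
  ex_series (fun k => if (Z.of_nat k + z <? 0)%Z then 0 else phi (Z.to_nat (Z.of_nat k + z))).
Proof.
  intros H. destruct (Z_le_gt_dec 0 z) as [Hz | Hz].
  - apply (ex_series_shift _ (Z.to_nat z)) in H. eapply ex_series_ext; [| exact H].
    intros k. simpl. rewrite (proj2 (Z.ltb_ge _ _)) by lia. f_equal. lia.
  - destruct H as [l H]. exists l. apply (is_series_pad _ _ (Z.to_nat (- z))) in H.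
    eapply is_series_ext; [| exact H]. intros k. simpl.
    destruct (Nat.ltb_spec k (Z.to_nat (- z))).
    + rewrite (proj2 (Z.ltb_lt _ _)) by lia. reflexivity.
    + rewrite (proj2 (Z.ltb_ge _ _)) by lia. f_equal. lia.
Qed.

Lemma fin_Z_bound d (m : Fin.t d -> Z) : exists M : nat, forall i, (Z.abs (m i) <= Z.of_nat M)%Z.
Proof.
  induction d.
  - exists 0%nat. intros i. exact (Fin.case0 (fun i => (Z.abs (m i) <= Z.of_nat 0)%Z) i).
  - destruct (IHd (fun i => m (Fin.FS i))) as [M HM].
    exists (M + Z.to_nat (Z.abs (m Fin.F1)))%nat. intros i.
    apply (Fin.caseS' i); [lia |]. intros j. specialize (HM j). lia.
Qed.

Section Coordinates.
Context {X : IPS} (HX : is_hilbert X) {d : nat}.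

Lemma in_H2_coord (F : nat -> powIPS X d) i : in_H2 F -> in_H2 (fun k => F k i).
Proof.
  rewrite (in_H2_ex_series (pow_hilbert HX d)). apply (in_H2_le HX). intros k.
  rewrite <- (vnorm_sqr HX), <- (vnorm_sqr (pow_hilbert HX d)). apply pow_incr.
  split; [apply vnorm_ge0 | apply (vnorm_coord_le HX)].
Qed.

(** [B] stands for [reip] or [imip], so both parts of the inner product are treated at once. *)
Lemma is_series_pow (B : X -> X -> R) (F G : nat -> powIPS X d) :
  (forall i, ex_series (fun k => B (F k i) (G k i))) ->
  is_series (fun k => Cre (finsum d (fun i => CR (B (F k i) (G k i)))))
            (Cre (finsum d (fun i => CR (Series (fun k => B (F k i) (G k i)))))).
Proof.
  intros H. apply (is_series_finsum_re d (fun k i => CR (B (F k i) (G k i)))).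
  intros i. apply Series_correct, H.
Qed.

Lemma in_H2_pow (F : nat -> powIPS X d) : (forall i, in_H2 (fun k => F k i)) -> in_H2 F.
Proof.
  intros H. apply (in_H2_ex_series (pow_hilbert HX d)).
  eexists. eapply is_series_ext; [intros k; symmetry; apply reip_pow |].
  apply (is_series_pow reip F F). intros i. apply (in_H2_ex_series HX), H.
Qed.

(** For [f] and [m] these are the vectors of the theorem. The same operation with $m_i - M$ realigns
    the orthogonal function [h]. *)
Definition shifted (F : nat -> powIPS X d) (m : Fin.t d -> Z) (k : nat) : powIPS X d :=
  fun i => fhat (fun j => F j i) (Z.of_nat k + m i)%Z.

Lemma in_H2_shifted F m : in_H2 F -> in_H2 (shifted F m).
Proof.
  intros H. apply in_H2_pow. intros i. apply (in_H2_coord F i) in H.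
  apply (in_H2_ex_series HX) in H. apply (in_H2_ex_series HX).
  apply (ex_series_fhat _ (m i)) in H. eapply ex_series_ext; [| exact H].
  intros k. simpl. unfold shifted, fhat.
  destruct (Z.of_nat k + m i <? 0)%Z; [rewrite (reip_zerol HX) |]; reflexivity.
Qed.

(** In coordinate $i$ put $s = t + (M - m_i)$: then $s + n + m_i = t + n + M$ and $s + m_i - M = t$.
    Since $M \ge m_i$, the realignment of [G] only prepends zeros, and those terms vanish by the
    hypothesis on [B]. *)
Lemma Series_shifted (B : X -> X -> R) (F G : nat -> powIPS X d) m M n :
  (forall x, B x vzero = 0) -> (forall i, Z.abs (m i) <= Z.of_nat M)%Z ->
  (forall i, ex_series (fun t => B (F (t + (n + M))%nat i) (G t i))) ->
  Series (fun s => Cre (finsum d (fun i =>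
    CR (B (shifted F m (s + n) i) (shifted G (fun i => m i - Z.of_nat M)%Z s i))))) =
  Series (fun t => Cre (finsum d (fun i => CR (B (F (t + (n + M))%nat i) (G t i))))).
Proof.
  intros B0 HM ex.
  assert (E := is_series_pow B (fun t => F (t + (n + M))%nat) G ex).
  rewrite (is_series_unique _ _ E). apply is_series_unique.
  apply (is_series_finsum_re d (fun s i =>
    CR (B (shifted F m (s + n) i) (shifted G (fun i => m i - Z.of_nat M)%Z s i)))).
  intros i. specialize (HM i).
  pose proof (is_series_pad _ _ (Z.to_nat (Z.of_nat M - m i)) (Series_correct _ (ex i))) as P.
  eapply is_series_ext; [| exact P]. intros s. simpl.
  unfold shifted, fhat. destruct (Nat.ltb_spec s (Z.to_nat (Z.of_nat M - m i))).
  - rewrite (proj2 (Z.ltb_lt (Z.of_nat s + (m i - Z.of_nat M)) 0)) by lia. symmetry. apply B0.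
  - rewrite (proj2 (Z.ltb_ge (Z.of_nat s + (m i - Z.of_nat M)) 0)) by lia.
    rewrite (proj2 (Z.ltb_ge (Z.of_nat (s + n) + m i) 0)) by lia.
    replace (Z.to_nat (Z.of_nat (s + n) + m i))
      with (s - Z.to_nat (Z.of_nat M - m i) + (n + M))%nat by lia.
    replace (Z.to_nat (Z.of_nat s + (m i - Z.of_nat M)))
      with (s - Z.to_nat (Z.of_nat M - m i))%nat by lia.
    reflexivity.
Qed.

Lemma shifted_support F m Lam k :
  (forall i, spec_in_shift (fun j => F j i) Lam (m i)) -> shifted F m k <> vzero -> Lam k.
Proof.
  intros Hspec Hk.
  assert (ex : exists i, shifted F m k i <> vzero).
  { apply NNPP; intros C. apply Hk. apply functional_extensionality; intros i.
    apply NNPP; intros Ci. apply C. exists i. exact Ci. }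
  destruct ex as [i Hi]. unfold shifted, fhat in Hi.
  destruct (Z.ltb_spec (Z.of_nat k + m i) 0); [congruence |].
  destruct (Hspec i _ Hi) as (l & Ll & El). replace k with l by lia. exact Ll.
Qed.

(** * Cyclicity implies spanning tails *)

Lemma cyclic_span_tail (f : nat -> powIPS X d) (m : Fin.t d -> Z) N :
  cyclic_bshift f -> span_tail_full (shifted f m) N.
Proof.
  intros cyc y eps He. destruct (fin_Z_bound d m) as [M0 HM0].
  (* [M0] makes every $M + m_i$ nonnegative, and [N] makes $M \ge N$. *)
  set (M := (M0 + N)%nat).
  pose (pos := fun i => Z.to_nat (Z.of_nat M + m i)).
  pose (G := (fun k i => if (k =? pos i)%nat then y i else vzero) : nat -> powIPS X d).
  assert (HG : in_H2 G).
  { apply in_H2_pow. intros i. apply (in_H2_ex_series HX).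
    apply (ex_series_incr_n _ (S (pos i))).
    apply ex_series_ext with (fun _ => 0); [| exists 0; exact is_series_zero].
    intros k. unfold G. rewrite (proj2 (Nat.eqb_neq _ _)) by lia. symmetry. apply (reip_zerol HX). }
  destruct (cyc G HG eps He) as (P & c & s & Hs & Hlt).
  pose (D := fun k => vsub (G k) (vsum P (fun n => vscal (c n) (bshift_iter n f k)))).
  (* The combination uses the vectors of index $M + n = N + (M0 + n)$, so the first [M0] vectors of
     the tail get coefficient zero. *)
  exists (M0 + P)%nat, (fun j => if (j <? M0)%nat then C0 else c (j - M0)%nat).
  assert (Ecomb : vsum (M0 + P) (fun j => vscal (if (j <? M0)%nat then C0 else c (j - M0)%nat)
                                            (shifted f m (N + j))) =
                  vsum P (fun n => vscal (c n) (shifted f m (M + n)))).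
  { pose proof (pow_hilbert HX d) as HV. rewrite (vsum_split HV), (vsum_eq0 HV M0).
    - rewrite (vsum_ext P _ (fun n => vscal (c n) (shifted f m (M + n)))); [vring HV |].
      intros j _. rewrite (proj2 (Nat.ltb_ge _ _)) by lia.
      replace (M0 + j - M0)%nat with j by lia. unfold M.
      replace (N + (M0 + j))%nat with (M0 + N + j)%nat by lia. reflexivity.
    - intros j Hj. rewrite (proj2 (Nat.ltb_lt _ _)) by exact Hj. vring HV. }
  rewrite Ecomb. apply (vnorm_lt (pow_hilbert HX d)); [lra |].
  eapply Rle_lt_trans; [| exact Hlt].
  assert (HD : in_H2 D) by (exists s; exact Hs).
  assert (coordex : forall i, ex_series (fun k => reip (D k i) (D k i))).
  { intros i. apply (in_H2_ex_series HX (fun k => D k i)), in_H2_coord, HD. }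
  assert (Es : s = Cre (finsum d (fun i => CR (Series (fun k => reip (D k i) (D k i)))))).
  { apply is_series_Reals in Hs. rewrite <- (is_series_unique _ _ Hs).
    apply is_series_unique. refine (is_series_ext _ _ _ _ (is_series_pow reip D D coordex)).
    intros k. rewrite (vnorm_sqr (pow_hilbert HX d)), reip_pow. reflexivity. }
  (* The coordinates are read off at different orders [pos i], so the comparison is made per
     coordinate: one term against the whole coordinate series. *)
  rewrite Es, reip_pow. apply finsum_re_le. intros i. simpl.
  eapply Rle_trans; [| apply (term_le_Series _ (pos i) (fun k => reip_self_ge0 HX (D k i)) (coordex i))].
  right.
  assert (E : vsub y (vsum P (fun n => vscal (c n) (shifted f m (M + n)))) i = D (pos i) i).
  { unfold D, vsub. simpl. rewrite !vsum_coord. unfold G. rewrite Nat.eqb_refl. f_equal. f_equal.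
    apply vsum_ext. intros n _. simpl. f_equal. unfold shifted, fhat, bshift_iter, pos.
    specialize (HM0 i). rewrite (proj2 (Z.ltb_ge _ _)) by lia. f_equal. lia. }
  exact (f_equal (fun v => reip v v) E).
Qed.

(** * Spanning tails imply cyclicity *)

Lemma span_tail_cyclic (Lam : nat -> Prop) (f : nat -> powIPS X d) (m : Fin.t d -> Z) :
  lacunary_infinite Lam -> in_H2 f ->
  (forall i, spec_in_shift (fun j => f j i) Lam (m i)) ->
  completely_rel_compact (shifted f m) ->
  (forall N, span_tail_full (shifted f m) N) -> cyclic_bshift f.
Proof.
  intros HLam Hf Hspec Hcomp Hspan G HG eps He.
  destruct (lacunary_has_ratio Lam HLam) as (c & Hc & ratio).
  destruct (fin_Z_bound d m) as [M HM].
  pose proof (pow_hilbert HX d) as HV. pose proof (l2_hilbert HV) as HL.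
  pose (Gl := exist _ G HG : l2_space HV).
  pose (Sf := fun n => exist _ _ (in_H2_bshift HV n f Hf) : l2_space HV).
  (* [q] lies in the closed span of the backward shifts of [f], and $h = G - q$ is orthogonal to all
     of them. It remains to show $h = 0$. *)
  destruct (nearest_point HL (lin_span Sf) Gl (lin_span_subspace HL Sf)) as (q & Hq & orth).
  pose (h := coef HV (vsub Gl q)).
  assert (Hh : in_H2 h) by apply coef_in_H2.
  assert (orth' : forall n, Series (fun t => reip (f (t + n)%nat) (h t)) = 0 /\
                            Series (fun t => imip (f (t + n)%nat) (h t)) = 0).
  { intros n. pose proof (orth _ (lin_span_mem HL Sf n)) as O.
    split; [exact (f_equal Cre O) | exact (f_equal Cim O)]. }
  assert (coordex : forall n i, ex_series (fun t => reip (f (t + n)%nat i) (h t i)) /\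
                                ex_series (fun t => imip (f (t + n)%nat i) (h t i))).
  { intros n i. apply (ex_series_inner HX (fun t => bshift_iter n f t i) (fun t => h t i));
      apply in_H2_coord; [apply (in_H2_bshift HV), Hf | exact Hh]. }
  assert (h0 : forall t, h t = vzero).
  (* The relation of order $n$ between the shifted sequences is the orthogonality of [h] to the
     shift of [f] by $n + M$. *)
  { assert (ht0 : forall p, shifted h (fun i => m i - Z.of_nat M)%Z p = vzero).
    { apply (lacunary_orthogonal_eq0 HV c Lam (shifted f m)); auto.
      - apply in_H2_shifted, Hf.
      - apply in_H2_shifted, Hh.
      - intros k. apply shifted_support, Hspec.
      - intros n. destruct (orth' (n + M)%nat) as [O1 O2]. split.
        + rewrite <- O1.
          rewrite (Series_ext _ _ (fun s => reip_pow d _ _)).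
          rewrite (Series_ext (fun t => reip _ (h t)) _ (fun s => reip_pow d _ _)).
          apply Series_shifted; [| exact HM | apply coordex].
          intros x. rewrite (reip_sym HX). apply (reip_zerol HX).
        + rewrite <- O2.
          rewrite (Series_ext _ _ (fun s => imip_pow d _ _)).
          rewrite (Series_ext (fun t => imip _ (h t)) _ (fun s => imip_pow d _ _)).
          apply Series_shifted; [| exact HM | apply coordex].
          intros x. unfold imip. rewrite (inner_sym HX vzero), (inner_zerol HX). simpl. ring. }
    intros t. apply functional_extensionality; intros i. specialize (HM i).
    (* As $m_i - M \le 0$, no coefficient is lost: that of order $t$ reappears at index $t + (M -
       m_i)$. *)
    pose proof (f_equal (fun v => v i) (ht0 (t + Z.to_nat (Z.of_nat M - m i))%nat)) as E.
    simpl in E. unfold shifted, fhat in E. rewrite (proj2 (Z.ltb_ge _ _)) in E by lia.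
    replace (Z.to_nat _) with t in E by lia. exact E. }
  assert (Eq : q = Gl).
  { symmetry. apply (vsub_eq0 HL). apply l2_ext. intros k. apply h0. }
  subst q. destruct (Hq eps He) as (e & (N & co & Ee) & Hlt).
  exists N, co. exists (Series (fun k => reip (coef HV (vsub Gl e) k) (coef HV (vsub Gl e) k))).
  split.
  - apply is_series_Reals.
    refine (is_series_ext _ _ _ _ (Series_correct _ (coef_ex_series HV (vsub Gl e)))).
    intros k. rewrite (vnorm_sqr HV).
    assert (E : coef HV (vsub Gl e) k = vsub (G k) (vsum N (fun n => vscal (co n) (bshift_iter n f k)))).
    { change (vsub (G k) (coef HV e k) =
        vsub (G k) (vsum N (fun n => vscal (co n) (bshift_iter n f k)))).
      rewrite Ee, vsum_coef. reflexivity. }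
    rewrite E. reflexivity.
  - change (Series _) with (reip (vsub Gl e) (vsub Gl e)). rewrite <- (vnorm_sqr HL).
    pose proof (vnorm_ge0 (vsub Gl e)). nra.
Qed.
End Coordinates.

(** * The cyclicity criterion *)

Theorem mainTheorem13 (X : IPS) (HX : is_hilbert X) (Hsep : separable X)
  (Lam : nat -> Prop) (HLam : lacunary_infinite Lam)
  (d : nat) (m : Fin.t d -> Z)
  (f : nat -> powIPS X d) (Hf : in_H2 f)
  (Hspec : forall i : Fin.t d, spec_in_shift (fun j => f j i) Lam (m i))
  (Hcomp : completely_rel_compact
             (fun k : nat => (fun i : Fin.t d =>
                 fhat (fun j => f j i) (Z.of_nat k + m i)%Z) : powIPS X d)) :
  cyclic_bshift f <->
  (forall N : nat,
     span_tail_full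
       (fun k : nat => (fun i : Fin.t d =>
           fhat (fun j => f j i) (Z.of_nat k + m i)%Z) : powIPS X d) N).
Proof.
  split.
  - intros cyc N. exact (cyclic_span_tail HX f m N cyc).
  - exact (span_tail_cyclic HX Lam f m HLam Hf Hspec Hcomp).
Qed.
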